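(* Let $m,a\ge0$ and $\ell\ge1$ be integers, and let $\mathcal{B}^0_\ell(m,a)$ be the arrangement in $\mathbb{R}^\ell$ consisting of the hyperplanes $x_i+x_j=s$ and $x_i-x_j=s$ for $1\le i<j\le\ell$ and integers $-a\le s\le a$, and $x_i=s$ for $1\le i\le\ell$ and integers $-m\le s\le m$. Then the cone $\mathbf{c}\mathcal{B}^0_\ell(m,a)$ is flag-accurate. In particular, the extended Catalan arrangement $\mathrm{Cat}^m(B_\ell)=\mathcal{B}^0_\ell(m,m)$ of type $B_\ell$ has flag-accurate cone with exponents $(1,\ 2m\ell+2i-1)_{i=1}^{\ell}$, i.e. $1,2m\ell+1,2m\ell+3,\dots,2m\ell+2\ell-1$.
   Context: For an affine arrangement $\mathcal{A}$ in $\mathbb{R}^\ell$, its cone $\mathbf{c}\mathcal{A}$ is the central arrangement in $V'=\mathbb{R}^{\ell+1}$ (extra coordinate $z$) consisting of the hyperplanes $a_1x_1+\dots+a_\ell x_\ell=dz$ for each hyperplane $a_1x_1+\dots+a_\ell x_\ell=d$ of $\mathcal{A}$, together with $z=0$. For a central arrangement $\mathcal{A}$ in $W=\mathbb{R}^n$: $L(\mathcal{A})$ is the set of intersections of subsets of $\mathcal{A}$ (including $W$); $\mathcal{A}^X=\{H\cap X:H\in\mathcal{A},X\not\subseteq H\}$; $\mathcal{A}$ is free if $D(\mathcal{A})=\{\theta\in\mathrm{Der}(S):\theta(\alpha_H)\in\alpha_HS\ \forall H\}$ is free over $S=\mathbb{R}[x_1,\dots,x_n]$, exponents being degrees of a homogeneous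 basis. $\mathcal{A}$ is flag-accurate if it is free with exponents $e_1\le\dots\le e_n$ and there is a flag $X_1\subseteq\dots\subseteq X_n=W$ in $L(\mathcal{A})$ with $\dim X_d=d$ and $\mathcal{A}^{X_d}$ free with exponents $(e_1,\dots,e_d)$ for all $d$. *)

(* Defs.v *)
From HB Require Import structures.
From mathcomp Require Import all_boot all_order all_algebra.
From mathcomp Require Import reals mpoly.

Set Implicit Arguments.
Unset Strict Implicit.
Unset Printing Implicit Defensive.

Import Order.TTheory GRing.Theory Num.Theory.
Local Open Scope ring_scope.

(* Arrangements are given by finite sequences; every notion below depends only
   on membership, so the order and repetitions are irrelevant. *)

Section Free.
Context {R : realType} {n : nat}.
Local Notation S := {mpoly R[n]}.

(* The linear form c_1 x_1 + ... + c_n x_n, as a polynomial, and its kernel. *)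
Definition linform (c : 'rV[R]_n) : S := \sum_(i < n) c 0 i *: 'X_i.

Definition hyperplane (c : 'rV[R]_n) : {vspace 'rV[R]_n} :=
  lker (linfun (mulmxr c^T : 'rV[R]_n -> 'M[R]_1)).

Definition derivation (theta : {linear S -> S}) : Prop :=
  forall f g : S, theta (f * g) = theta f * g + f * theta g.

(* Polynomial degree d: theta = \sum_i f_i d/dx_i with all f_i in S_d. *)
Definition homog_derivation (d : nat) (theta : {linear S -> S}) : Prop :=
  forall i : 'I_n, theta 'X_i \is d.-homog.

(* alpha_H is determined by H up to a nonzero scalar, which is immaterial for
   the condition theta(alpha_H) \in alpha_H S; we ask it of every choice. *)
Definition logder (A : seq {vspace 'rV[R]_n}) (theta : {linear S -> S}) : Prop :=
  derivation theta /\
  forall H, H \in A -> forall c, hyperplane c = H ->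
    exists q : S, theta (linform c) = linform c * q.

Definition logder_basis (A : seq {vspace 'rV[R]_n}) (r : nat)
    (theta : 'I_r -> {linear S -> S}) : Prop :=
  (forall i, logder A (theta i)) /\
  forall eta : {linear S -> S}, logder A eta ->
    exists! f : {ffun 'I_r -> S},
      forall p : S, eta p = \sum_(i < r) f i * theta i p.

Definition free_with_exponents (A : seq {vspace 'rV[R]_n}) (e : seq nat) : Prop :=
  exists theta : 'I_(size e) -> {linear S -> S},
    logder_basis A theta /\
    forall i : 'I_(size e), homog_derivation (nth 0%N e i) (theta i).

End Free.

Section Flag.
Context {R : realType}.

Definition in_lattice (V : vectType R) (A : seq {vspace V}) (X : {vspace V}) :
    Prop :=
  exists2 B : seq {vspace V}, {subset B <= A} & X = (\bigcap_(H <- B) H)%VS.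

Definition restriction (V : vectType R) (A : seq {vspace V}) (X : {vspace V}) :
    seq {vspace subvs_of X} :=
  [seq (linfun (vsval : subvs_of X -> V) @^-1: (H :&: X))%VS
     | H <- A & ~~ (X <= H)%VS].

(* Freeness of an arrangement in a d-dimensional space U, which is identified
   with R^d by a choice of linear coordinates; the choice is immaterial, as a
   linear change of coordinates is a degree-preserving automorphism of S. *)
Definition free_in (d : nat) (U : vectType R) (A : seq {vspace U})
    (e : seq nat) : Prop :=
  exists phi : 'Hom('rV[R]_d, U),
    bijective phi /\ free_with_exponents [seq (phi @^-1: H)%VS | H <- A] e.

Definition flag_accurate_with (n : nat) (A : seq {vspace 'rV[R]_n})
    (e : seq nat) : Prop :=
  [/\ size e = n, sorted leq e, free_with_exponents A e &
      exists X : nat -> {vspace 'rV[R]_n},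
        [/\ X n = fullv,
            forall d, (1 <= d < n)%N -> (X d <= X d.+1)%VS &
            forall d, (1 <= d <= n)%N ->
              [/\ in_lattice A (X d), \dim (X d) = d &
                  free_in d (restriction A (X d)) (take d e)]]].

Definition flag_accurate (n : nat) (A : seq {vspace 'rV[R]_n}) : Prop :=
  exists e : seq nat, flag_accurate_with A e.

End Flag.

Section Arrangements.
Context {R : realType}.

(* The pair (a, d) stands for the affine hyperplane a_1 x_1 + ... + a_l x_l = d;
   in the cone the extra coordinate z comes last. *)
Definition cone (l : nat) (A : seq ('rV[R]_l * R)) :
    seq {vspace 'rV[R]_(l + 1)} :=
  hyperplane (row_mx 0 1%:M)
    :: [seq hyperplane (row_mx p.1 (- p.2)%:M) | p <- A].

(* The integers -k, ..., k, as reals. *)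
Definition int_range (k : nat) : seq R :=
  [seq (i%:Z - k%:Z)%:~R | i <- iota 0 k.*2.+1].

Definition index_pairs (l : nat) : seq ('I_l * 'I_l) :=
  [seq p <- enum predT | (nat_of_ord p.1 < nat_of_ord p.2)%N].

Definition unitv (l : nat) (i : 'I_l) : 'rV[R]_l := delta_mx 0 i.

Definition B0 (l m a : nat) : seq ('rV[R]_l * R) :=
  [seq (unitv p.1 + unitv p.2, s) | p <- index_pairs l, s <- int_range a] ++
  [seq (unitv p.1 - unitv p.2, s) | p <- index_pairs l, s <- int_range a] ++
  [seq (unitv i, s) | i <- enum 'I_l, s <- int_range m].

Definition CatB (l m : nat) : seq ('rV[R]_l * R) := B0 l m m.

End Arrangements.

Arguments B0 R l m a : clear implicits.
Arguments CatB R l m : clear implicits.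

(* Main.v *)
(** Idea. Put [w = z / 2] and consider derivations [sum_i F(x_i) d/dx_i] where [F] is
odd in [t] and [F(t + z) - F(t) = z (G(t) + G(- z - t))] with
[G(t) = A(t) prod_k prod_(u < a) ((t - u z)^2 - x_k^2)]. If [y' = y + s z] with
[y, y'] among the [+- x_k] and [0 <= s <= a], then [G] vanishes at every step from [y] to
[y'], so [F(y') = F(y)]: this is divisibility along [x_i +- x_j = s z]. The rational
function [A], of degree [2 (n - a)], has zeros at integers, which make [F(x_i)] vanish on
[x_i = s z] for [|s| <= n], and poles at the half-integers below [a] (and at integers when
[2 n < a]); these poles lower the degree to the required one. The residues of [G(t) + G(- z - t)]
cancel in pairs, so [F] is rational in [t], and each residue is divisible by the [x_i - p z] at
which it produces a pole, so [F(x_i)] is a polynomial. Modulo [z] the difference equation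
becomes the Euler equation [t N' - e N = 0] for the numerator [N] of [F], whose only
solutions have the wrong parity; hence no denominator in [z] is lost, and the value at
[z = 0] is the antiderivative of [t^(2 (n - a)) prod_k (t^2 - x_k^2)^a], by which the
derivations for [n = m, ..., m + l - 1] are independent. With the Euler derivation they
form a basis by Saito's criterion, so the cone over [B^0_l(m,a)] is free for all [l], [m],
[a]. Finally, restricting it to [x_l = m z] gives the cone over [B^0_(l-1)(m + a, a)], whose
exponents are the first [l] ones, and iterating produces the flag. *)

From HB Require Import structures.
Require Import Defs.
From mathcomp Require Import all_boot all_order all_algebra.
From mathcomp Require Import reals mpoly.
From mathcomp Require Import perm ring lra zify.

Set Implicit Arguments.
Unset Strict Implicit.
Unset Printing Implicit Defensive.
Import Order.TTheory GRing.Theory Num.Theory.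

Local Open Scope ring_scope.

(** * Interpolation and antidifferences *)

Lemma prod_XsubC_dvd (S : idomainType) (s : seq S) (p : {poly S}) :
  uniq s -> (forall y, y \in s -> p.[y] = 0) ->
  exists q, p = (\prod_(y <- s) ('X - y%:P)) * q.
Proof.
elim: s p => [|y s IH] p /=; first by exists p; rewrite big_nil mul1r.
case/andP=> ys us hp.
have /factor_theorem[q pE] : root p y by rewrite /root hp ?mem_head.
have hq t : t \in s -> q.[t] = 0.
  move=> ts; have := hp t; rewrite inE ts orbT pE hornerM hornerXsubC.
  move=> /(_ isT) /eqP; rewrite mulf_eq0 subr_eq0 => /orP[/eqP //|/eqP ty].
  by rewrite -ty ts in ys.
have [q' qE] := IH q us hq.
by exists q'; rewrite big_cons pE qE mulrC mulrA.
Qed.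

Lemma lagrange_divisor (S : idomainType) (s : seq S) (g : {poly S}) :
  uniq s ->
  exists (h : {poly S}) (b : S -> S),
    (\prod_(y <- s) \prod_(t <- s | t != y) (y - t)) *: g =
    (\prod_(y <- s) ('X - y%:P)) * h +
    \sum_(y <- s) (b y * g.[y]) *: \prod_(t <- s | t != y) ('X - t%:P).
Proof.
move=> us.
pose d y := \prod_(t <- s | t != y) (y - t).
pose b y := \prod_(t <- s | t != y) d t.
pose r := (\prod_(y <- s) d y) *: g -
  \sum_(y <- s) (b y * g.[y]) *: \prod_(t <- s | t != y) ('X - t%:P).
have [y ys|h hE] := @prod_XsubC_dvd _ s r us; last first.
  by exists h, b; apply/eqP; rewrite -subr_eq; apply/eqP.
rewrite /r hornerD hornerN hornerZ horner_sum (bigD1_seq y) //= [X in _ - X](bigD1_seq y) //=.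
rewrite [X in _ - (_ + X)]big1 ?addr0 => [|t ty]; last first.
  rewrite hornerZ horner_prod; apply/eqP; rewrite mulf_eq0; apply/orP; right.
  rewrite prodf_seq_eq0; apply/hasP; exists y => //.
  by rewrite hornerXsubC subrr eqxx eq_sym ty.
rewrite hornerZ horner_prod /b.
under [X in _ - _ * X]eq_bigr do rewrite hornerXsubC.
by rewrite -/(d y); ring.
Qed.

Section Antidifference.
Variables (S : idomainType) (z : S).
Hypothesis hU : forall k, (k.+1%:R : S) \is a GRing.unit.

Definition fallpoly k : {poly S} := \prod_(v < k) ('X - (z *+ v)%:P).

Lemma fallpoly_diff k :
  fallpoly k.+1 \Po ('X + z%:P) - fallpoly k.+1 = (z *+ k.+1) *: fallpoly k.
Proof.
rewrite {1}/fallpoly big_ord_recl /= mulr0n polyC0 subr0.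
rewrite comp_polyM comp_polyX rmorph_prod /=.
under eq_bigr => v _.
  rewrite comp_polyB comp_polyX comp_polyC /bump /= add1n mulrSr polyCD opprD addrACA subrr addr0.
  over.
rewrite -/(fallpoly k) /fallpoly big_ord_recr /= -/(fallpoly k).
by rewrite -mul_polyC mulrSr polyCD; ring.
Qed.

Lemma size_fallpoly k : size (fallpoly k) = k.+1.
Proof. by rewrite /fallpoly -big_enum size_prod_XsubC size_enum_ord. Qed.

Lemma monic_fallpoly k : fallpoly k \is monic.
Proof. exact: monic_prod_XsubC. Qed.

Lemma antidifference (h : {poly S}) :
  exists A : {poly S}, A \Po ('X + z%:P) - A = z *: h.
Proof.
have [k] := ubnP (size h); elim: k h => [//|k IH] h sh.
have [->|h0] := eqVneq h 0; first by exists 0; rewrite comp_poly0 subr0 scaler0.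
pose j := (size h).-1.
have sj : size h = j.+1 by rewrite prednK // size_poly_gt0.
pose h' := h - lead_coef h *: fallpoly j.
have h'j : (size h' <= j)%N.
  apply/leq_sizeP => i; rewrite leq_eqVlt => /orP[/eqP <-|ji].
    rewrite coefB coefZ; have := monic_fallpoly j; rewrite monicE lead_coefE size_fallpoly /=.
    by move/eqP ->; rewrite mulr1 lead_coefE -/j subrr.
  rewrite coefB coefZ [X in X - _]nth_default ?sj // [(fallpoly j)`_i]nth_default ?size_fallpoly //.
  by rewrite mulr0 subr0.
have [|A AE] := IH h'; first by apply: leq_ltn_trans h'j _; move: sh; rewrite sj ltnS.
exists (A + (lead_coef h / j.+1%:R) *: fallpoly j.+1).
rewrite comp_polyD comp_polyZ opprD addrACA AE -scalerBr fallpoly_diff.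
rewrite scalerA /h' scalerBr scalerA -[z *+ j.+1]mulr_natr.
have -> : lead_coef h / j.+1%:R * (z * j.+1%:R) = z * lead_coef h.
  by rewrite mulrCA divrK ?hU // mulrC.
by rewrite addrNK.
Qed.

End Antidifference.

(** * The products defining the difference equation *)

Section Products.
Variables (l a n : nat).

(* Here and below [w] stands for [z / 2], so that half-integral shifts are multiples of [w]. *)
Definition pairprod (T : comNzRingType) (w : T) (x : 'I_l -> T) (t : T) : T :=
  \prod_(k < l) \prod_(u < a) ((t - w *+ (2 * u)) ^+ 2 - x k ^+ 2).

(* Truncated subtraction does the case distinction: [zeroprod] is 1 when [2 n <= a], and
   [poles] contains no even number when [a <= 2 n]. *)
Definition zeroprod (T : comNzRingType) (w t : T) : T :=
  \prod_(v < 2 * n - a) (t + w *+ (2 * n) - w *+ (2 * (a + v))).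

Definition poles : seq nat :=
  [seq (2 * u + 1)%N | u <- iota 0 a] ++ [seq (2 * v)%N | v <- iota n (a - 2 * n)].

(* The cofactor of [x_i - (k - 2 r) w] in [pairprod] at [t = k w]. The factor with the excluded
   index [u] is [(k - 2 r)^2 w^2 - x_i^2] in both cases. *)
Definition paircofactor (T : comNzRingType) (w : T) (x : 'I_l -> T) (i : 'I_l)
    (k r : nat) : T :=
  - (x i + (w *+ k - w *+ (2 * r))) *
  \prod_(u < a | u != (if r < a then r else k - r)%N :> nat)
     ((w *+ k - w *+ (2 * u)) ^+ 2 - x i ^+ 2) *
  \prod_(j < l | j != i) \prod_(u < a) ((w *+ k - w *+ (2 * u)) ^+ 2 - x j ^+ 2).

Lemma poles_uniq : uniq poles.
Proof.
rewrite cat_uniq !map_inj_uniq ?iota_uniq ?andbT /=.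
- by apply/hasPn => _ /mapP[v _ ->]; apply/mapP => -[u _]; lia.
- by move=> u v; lia.
- by move=> u v; lia.
Qed.

Lemma size_poles : size poles = (a + (a - 2 * n))%N.
Proof. by rewrite size_cat !size_map !size_iota. Qed.

Lemma poles_lt k : k \in poles -> (k < 2 * a)%N.
Proof.
by rewrite mem_cat => /orP[] /mapP[v]; rewrite mem_iota => ? ->; lia.
Qed.

Lemma rmorph_pairprod (T T' : comNzRingType) (f : {rmorphism T -> T'}) w x t :
  f (pairprod w x t) = pairprod (f w) (fun k => f (x k)) (f t).
Proof.
rewrite rmorph_prod; apply: eq_bigr => k _; rewrite rmorph_prod; apply: eq_bigr => u _.
by rewrite !(rmorphB, rmorphXn, rmorphMn).
Qed.

Lemma rmorph_zeroprod (T T' : comNzRingType) (f : {rmorphism T -> T'}) w t :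
  f (zeroprod w t) = zeroprod (f w) (f t).
Proof.
by rewrite rmorph_prod; apply: eq_bigr => u _; rewrite !(rmorphB, rmorphD, rmorphMn).
Qed.

Lemma rmorph_paircofactor (T T' : comNzRingType) (f : {rmorphism T -> T'}) w x i k r :
  f (paircofactor w x i k r) = paircofactor (f w) (fun j => f (x j)) i k r.
Proof.
rewrite /paircofactor !rmorphM !rmorph_prod rmorphN rmorphD rmorphB !rmorphMn.
congr (_ * _ * _).
  by apply: eq_bigr => u _; rewrite !(rmorphB, rmorphXn, rmorphMn).
apply: eq_bigr => j _; rewrite rmorph_prod; apply: eq_bigr => u _.
by rewrite !(rmorphB, rmorphXn, rmorphMn).
Qed.

Lemma pairprod_cofactor (T : comNzRingType) (w : T) x i k r :
  (k < 2 * a)%N -> (r <= k)%N ->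
  pairprod w x (w *+ k) =
  (x i - (w *+ k - w *+ (2 * r))) * paircofactor w x i k r.
Proof.
move=> ka rk; rewrite /pairprod /paircofactor (bigD1 i) //= mulrA; congr (_ * _).
have u0a : ((if r < a then r else k - r) < a)%N by case: ifP => ?; lia.
rewrite (bigD1 (Ordinal u0a)) //= mulrA; congr (_ * _).
set u := (if _ then _ else _).
have -> : (w *+ k - w *+ (2 * u)) ^+ 2 = (w *+ k - w *+ (2 * r)) ^+ 2; last by ring.
rewrite /u; case: ifP => // _; rewrite -(subnK rk) addnK !mul2n -!addnn !mulrnDr.
by ring.
Qed.

End Products.

Section Antiderivative.
Variables (S : idomainType) (l a n : nat) (w : S) (x : 'I_l -> S).
Variables (c : S) (h A : {poly S}) (beta : nat -> S).
Let z := w *+ 2.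
Let Q := poles a n.
Let g : {poly S} := zeroprod a n w%:P 'X * pairprod a w%:P (fun k => (x k)%:P) 'X.
Let rho k := beta k * (zeroprod a n w (w *+ k) * pairprod a w x (w *+ k)).
Hypothesis hA : A \Po ('X + z%:P) - A = z *: h.
Hypothesis hL : c *: g = (\prod_(k <- Q) ('X - (w *+ k)%:P)) * h +
  \sum_(k <- Q) rho k *: \prod_(j <- Q | j != k) ('X - (w *+ j)%:P).

(* The value at [x_i] of [Fhat] below, with the divisions carried out. *)
Definition antiderivative_at (i : 'I_l) : S :=
  A.[x i] - A.[- x i] - z * \sum_(k <- Q) beta k * zeroprod a n w (w *+ k) *
    \sum_(r < k.+1) paircofactor a w x i k r.

Section Eval.
Variables (K : fieldType) (phi : {rmorphism S -> K}).
Let wK := phi w.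
Let xK i := phi (x i).
Local Notation ev p := (map_poly phi p).

Definition Fhat (t : K) : K :=
  (ev A).[t] - (ev A).[- t] - phi z * \sum_(k <- Q) phi (rho k) *
    \sum_(r < k.+1) (t - (wK *+ k - wK *+ (2 * r)))^-1.

Definition Ghat (t : K) : K :=
  (ev h).[t] + \sum_(k <- Q) phi (rho k) / (t - wK *+ k).

Lemma evg t : (ev g).[t] = zeroprod a n wK t * pairprod a wK xK t.
Proof.
pose f : {rmorphism {poly S} -> K} := horner_eval t \o map_poly phi.
have fC u : f u%:P = phi u by rewrite /f /= map_polyC /horner_eval hornerC.
have fX : f 'X = t by rewrite /f /= map_polyX /horner_eval hornerX.
rewrite -[LHS]/(f g) /g rmorphM (rmorph_zeroprod _ _ f) (rmorph_pairprod _ f) fC fX.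
by congr (_ * _); apply: eq_bigr => k _; apply: eq_bigr => u _; rewrite fC.
Qed.

Lemma Fhat_opp t : Fhat (- t) = - Fhat t.
Proof.
rewrite /Fhat opprK !opprB [RHS]addrC.
have -> : \sum_(k <- Q) phi (rho k) * \sum_(r < k.+1) (- t - (wK *+ k - wK *+ (2 * r)))^-1
   = - \sum_(k <- Q) phi (rho k) * \sum_(r < k.+1) (t - (wK *+ k - wK *+ (2 * r)))^-1.
  rewrite -sumrN; apply: eq_bigr => k _; rewrite -mulrN; congr (_ * _).
  rewrite -sumrN (reindex_inj rev_ord_inj) /=; apply: eq_bigr => r _.
  rewrite -invrN; congr (_^-1); rewrite subSS.
  have : (r <= k)%N by rewrite -ltnS.
  move: (nat_of_ord r) => {}r rk.
  by rewrite -(subnK rk) addnK !mul2n -!addnn !mulrnDr; ring.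
by ring.
Qed.

(* Since [0^-1 = 0], the telescoping sum of inverses makes this valid at the poles as well. *)
Lemma Fhat_step t :
  Fhat (t + phi z) - Fhat t = phi z * (Ghat t + Ghat (- (phi z) - t)).
Proof.
have hAK s : (ev A).[s + phi z] - (ev A).[s] = phi z * (ev h).[s].
  have := congr1 (fun p => (ev p).[s]) hA.
  by rewrite /= rmorphB /= map_comp_poly rmorphD /= map_polyX map_polyC hornerD hornerN
     horner_comp hornerD hornerX hornerC map_polyZ hornerZ.
have h1 := hAK t; have h2 := hAK (- phi z - t).
rewrite (_ : - phi z - t + phi z = - t) in h2; last by ring.
rewrite /Fhat /Ghat (_ : - (t + phi z) = - phi z - t); last by ring.
have -> : \sum_(k <- Q) phi (rho k) * \sum_(r < k.+1) (t + phi z - (wK *+ k - wK *+ (2 * r)))^-1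
  = \sum_(k <- Q) phi (rho k) * \sum_(r < k.+1) (t - (wK *+ k - wK *+ (2 * r)))^-1
   - \sum_(k <- Q) phi (rho k) / (t - wK *+ k)
   - \sum_(k <- Q) phi (rho k) / (- phi z - t - wK *+ k).
  rewrite -!sumrB; apply: eq_bigr => k _; rewrite -!mulrBr; congr (_ * _).
  pose f r := (t - (wK *+ k - wK *+ (2 * r)))^-1.
  have -> : \sum_(r < k.+1) (t + phi z - (wK *+ k - wK *+ (2 * r)))^-1 =
     \sum_(r < k.+1) f r.+1.
    apply: eq_bigr => r _; congr (_^-1).
    by rewrite /z rmorphMn -/wK mulnS (mulrnDr _ 2%N); ring.
  rewrite -[X in _ = X - _ - _]/(\sum_(r < k.+1) f r).
  have -> : (- phi z - t - wK *+ k)^-1 = - f k.+1.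
    rewrite -invrN /f; congr (_^-1).
    by rewrite /z rmorphMn -/wK mulnS mul2n -addnn (mulrnDr _ 2%N) mulrnDr; ring.
  have -> : (t - wK *+ k)^-1 = f 0%N by rewrite /f muln0 mulr0n subr0.
  have : \sum_(r < k.+1) f r.+1 + f 0%N = \sum_(r < k.+1) f r + f k.+1.
    by rewrite addrC -(big_mkord xpredT f) -(big_ord_recl k.+1 (fun i => f (i : nat))) big_ord_recr big_mkord.
  by move=> e; apply: (addIr (f 0%N)); rewrite e; ring.
by rewrite !mulrDr -h1 -h2; ring.
Qed.

Lemma Ghat_den t : (forall k, k \in Q -> t != wK *+ k) ->
  \prod_(k <- Q) (t - wK *+ k) * Ghat t = phi c * (zeroprod a n wK t * pairprod a wK xK t).
Proof.
move=> ht; rewrite -evg.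
have evX k : (ev ('X - (w *+ k)%:P)).[t] = t - wK *+ k.
  rewrite rmorphB /= map_polyX map_polyC hornerXsubC; congr (_ - _).
  exact: (rmorphMn phi).
have := congr1 (fun p => (ev p).[t]) hL.
rewrite map_polyZ hornerZ => ->.
rewrite rmorphD rmorphM hornerD hornerM /Ghat mulrDr; congr (_ * _ + _).
  by rewrite rmorph_prod horner_prod; apply: eq_bigr => k _; rewrite evX.
rewrite /= rmorph_sum horner_sum mulr_sumr; apply: eq_big_seq => k kQ.
rewrite /= map_polyZ hornerZ /= rmorph_prod horner_prod (bigD1_seq k) ?poles_uniq //=.
under [in RHS]eq_bigr do rewrite evX.
by move: (ht k kQ); rewrite -subr_eq0; move: (t - wK *+ k) => d d0; field.
Qed.

Lemma Ghat_zero t : (forall k, k \in Q -> t != wK *+ k) ->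
  zeroprod a n wK t * pairprod a wK xK t = 0 -> Ghat t = 0.
Proof.
move=> ht h0; have := Ghat_den ht; rewrite h0 mulr0 => /eqP.
rewrite mulf_eq0 => /orP[|/eqP //]; rewrite prodf_seq_eq0 => /hasP[k kQ].
by rewrite /= subr_eq0 (negPf (ht _ kQ)).
Qed.

Lemma antiderivative_eval i :
  (forall k, k \in Q ->
     (forall r, (r <= k)%N -> xK i != wK *+ k - wK *+ (2 * r)) \/
     (forall r, (r <= k)%N -> phi (paircofactor a w x i k r) = 0)) ->
  phi (antiderivative_at i) = Fhat (xK i).
Proof.
move=> hi; rewrite /antiderivative_at /Fhat rmorphB rmorphM rmorph_sum; congr (_ - _ * _).
  by rewrite rmorphB -!horner_map rmorphN.
apply: eq_big_seq => k kQ; rewrite rmorphM rmorph_sum !mulr_sumr.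
apply: eq_bigr => r _; have rk : (r <= k)%N by rewrite -ltnS.
rewrite /rho (pairprod_cofactor w x i (poles_lt kQ) rk).
have hp : (phi (paircofactor a w x i k r) = 0) \/ (xK i != wK *+ k - wK *+ (2 * r)).
  by case: (hi k kQ) => /(_ r rk); [right|left].
move: (paircofactor a w x i k r) (zeroprod a n w (w *+ k)) hp => p q hp.
rewrite !rmorphM /= !rmorphB !rmorphMn -/wK -/(xK i).
case: hp => [->|]; first by rewrite !(mulr0, mul0r).
by rewrite -subr_eq0; move: (xK i - _) => d d0; field.
Qed.
End Eval.
End Antiderivative.

Section Conditions.
Variables (S : idomainType) (l a n : nat) (w : S) (x : 'I_l -> S).
Variables (c : S) (h A : {poly S}) (beta : nat -> S).
Let z := w *+ 2.
Let Q := poles a n.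
Let g : {poly S} := zeroprod a n w%:P 'X * pairprod a w%:P (fun k => (x k)%:P) 'X.
Let rho k := beta k * (zeroprod a n w (w *+ k) * pairprod a w x (w *+ k)).
Hypothesis hA : A \Po ('X + z%:P) - A = z *: h.
Hypothesis hL : c *: g = (\prod_(k <- Q) ('X - (w *+ k)%:P)) * h +
  \sum_(k <- Q) rho k *: \prod_(j <- Q | j != k) ('X - (w *+ j)%:P).
Variables (K : fieldType) (phi : {rmorphism S -> K}).
Let wK := phi w.
Let xK i := phi (x i).
Hypothesis K0 : forall k, (k.+1%:R : K) != 0.
Hypothesis wK0 : wK != 0.
Local Notation Fh := (Fhat a n w x A beta phi).
Local Notation Gh := (Ghat a n w x h beta phi).
Local Notation f := (antiderivative_at a n w x A beta).

Let phiz : phi z = wK *+ 2. Proof. by rewrite /z rmorphMn. Qed.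

Let wK_inj p q : wK *+ p = wK *+ q -> p = q.
Proof.
wlog le_pq : p q / (p <= q)%N => [H|].
  by have /orP[/H|/H H' /esym/H'] := leq_total p q.
move=> e; case: (ltngtP p q) le_pq => // pq _.
have := K0 (q - p).-1; rewrite prednK ?subn_gt0 // => /negP[].
by rewrite -(mulrI_eq0 _ (mulfI wK0)) mulr_natr mulrnBr ?(ltnW pq) // e subrr.
Qed.

Lemma Fhat_chain (t : K) (s : nat) :
  (forall u, (u < s)%N -> Gh (t + wK *+ (2 * u)) = 0 /\ Gh (- (t + wK *+ (2 * u.+1))) = 0) ->
  Fh (t + wK *+ (2 * s)) = Fh t.
Proof.
elim: s => [|s IH] hG; first by rewrite muln0 mulr0n addr0.
rewrite -IH => [|u us]; last by apply: hG; rewrite ltnS ltnW.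
have := Fhat_step a n x beta hA phi (t + wK *+ (2 * s)).
have [-> G2] := hG s (ltnSn s).
rewrite phiz (_ : - _ - _ = - (t + wK *+ (2 * s.+1))); last by ring.
rewrite G2 addr0 mulr0 => /eqP; rewrite subr_eq0 => /eqP <-.
by congr (Fh _); ring.
Qed.

Lemma pairprod_root (t : K) i u :
  (u < a)%N -> (t - wK *+ (2 * u)) ^+ 2 = xK i ^+ 2 -> pairprod a wK xK t = 0.
Proof.
move=> ua e; rewrite /pairprod (bigD1 i) //= (bigD1 (Ordinal ua)) //= e subrr.
by rewrite !mul0r.
Qed.

Lemma zeroprod_root (t : K) v :
  (v < 2 * n - a)%N -> t + wK *+ (2 * n) = wK *+ (2 * (a + v)) -> zeroprod a n wK t = 0.
Proof.
by move=> va e; rewrite /zeroprod (bigD1 (Ordinal va)) //= e subrr mul0r.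
Qed.

Definition nonint (t : K) := forall c : int, t <> wK *~ c.

Lemma nonint_add t (m : int) : nonint t -> nonint (t + wK *~ m).
Proof. by move=> ht d e; apply: (ht (d - m)); rewrite mulrzBr -e addrK. Qed.

Lemma nonint_opp t : nonint t -> nonint (- t).
Proof. by move=> ht d e; apply: (ht (- d)); rewrite mulrNz -e opprK. Qed.

Lemma Ghat_pair t i u : nonint t -> (u < a)%N ->
  (t - wK *+ (2 * u)) ^+ 2 = xK i ^+ 2 -> Gh t = 0.
Proof.
move=> ht ua e; apply: (Ghat_zero hL) => [k _|]; first by apply/eqP/(ht k).
by rewrite (pairprod_root ua e) mulr0.
Qed.

Lemma Fhat_pair t s i j : nonint t -> (s <= a)%N -> t ^+ 2 = xK j ^+ 2 ->
  (t + wK *+ (2 * s)) ^+ 2 = xK i ^+ 2 -> Fh (t + wK *+ (2 * s)) = Fh t.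
Proof.
move=> ht sa ej ei; apply: Fhat_chain => u us; split.
  apply: (@Ghat_pair _ j u); first exact: (@nonint_add _ (2 * u)%N).
    exact: leq_trans us sa.
  by rewrite addrK.
apply: (@Ghat_pair _ i (s - u.+1)).
- exact/nonint_opp/(@nonint_add _ (2 * u.+1)%N).
- lia.
rewrite -ei; have -> : s = (u.+1 + (s - u.+1))%N by rewrite subnKC.
by rewrite addKn; ring.
Qed.

Lemma antiderivative_eval_nonint i : nonint (xK i) -> phi (f i) = Fh (xK i).
Proof.
move=> hx; apply: antiderivative_eval => k _; left => r rk.
apply/eqP => e; apply: (hx (k%:Z - (2 * r)%N%:Z)).
by rewrite mulrzBr.
Qed.

Lemma antiderivative_pair i j (b b' : bool) s :
  nonint (xK j) -> (s <= a)%N ->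
  (-1) ^+ b * xK i = (-1) ^+ b' * xK j + phi z *+ s ->
  (-1) ^+ b * phi (f i) = (-1) ^+ b' * phi (f j).
Proof.
move=> hj sa; rewrite phiz -mulrnA => e.
have signN (d : bool) t : nonint t -> nonint ((-1) ^+ d * t).
  by case: d; rewrite ?(expr1, expr0, mulN1r, mul1r) // => /nonint_opp.
have Fs (d : bool) t : (-1) ^+ d * Fh t = Fh ((-1) ^+ d * t).
  by case: d; rewrite ?(expr1, expr0, mulN1r, mul1r) // Fhat_opp.
have ht : nonint ((-1) ^+ b' * xK j) by apply: signN.
have hi : nonint (xK i).
  rewrite -[xK i](signrMK b) e; apply: signN.
  exact: (@nonint_add _ (2 * s)%N).
rewrite !antiderivative_eval_nonint // !Fs e.
by apply: (@Fhat_pair _ s i j) => //; rewrite -?e exprMn sqrr_sign mul1r.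
Qed.

Lemma antiderivative_zero i (b : bool) s :
  (s <= n)%N -> xK i = (-1) ^+ b * (phi z *+ s) -> phi (f i) = 0.
Proof.
move=> sn; rewrite phiz -mulrnA => e.
have F0 : Fh 0 = 0.
  have := Fhat_opp a n w x A beta phi 0; rewrite oppr0 => /eqP.
  by rewrite -subr_eq0 opprK -mulr2n -mulr_natr mulf_eq0 (negPf (K0 1)) orbF => /eqP.
have e2 : (wK *+ (2 * s)) ^+ 2 = xK i ^+ 2 by rewrite e exprMn sqrr_sign mul1r.
have Fs : Fh (wK *+ (2 * s)) = 0.
  rewrite -F0 -[X in Fh X]add0r; apply: Fhat_chain => u us; rewrite !add0r; split.
    apply: (Ghat_zero hL) => [k kQ|].
      apply/eqP => /wK_inj uk; move: kQ; rewrite -uk mem_cat.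
      by case/orP=> /mapP[v]; rewrite mem_iota; lia.
    have [usa|] := ltnP (u + s) a.
      rewrite [pairprod _ _ _ _](@pairprod_root _ i _ usa) ?mulr0 //.
      by rewrite -e2; ring.
    move=> aus; rewrite (@zeroprod_root _ (u + n - a)) ?mul0r //; first lia.
    by rewrite -mulrnDr; congr (_ *+ _); lia.
  apply: (Ghat_zero hL) => [k kQ|].
    rewrite -subr_eq0 -opprD oppr_eq0 -mulrnDr; apply/eqP => /(@wK_inj _ 0); lia.
  have [usa|] := ltnP (s - u.+1) a.
    rewrite [pairprod _ _ _ _](@pairprod_root _ i _ usa) ?mulr0 //.
    rewrite -e2; have -> : s = (u.+1 + (s - u.+1))%N by rewrite subnKC.
    by rewrite addKn; ring.
  move=> aus; rewrite (@zeroprod_root _ (n - a - u.+1)) ?mul0r //; first lia.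
  rewrite addrC -mulrnBr; last lia.
  by congr (_ *+ _); lia.
rewrite antiderivative_eval => [|k].
  by rewrite -/(xK i) e; case: b {e}; rewrite ?(expr1, expr0, mulN1r, mul1r) // Fhat_opp Fs oppr0.
rewrite mem_cat => /orP[] /mapP[v]; rewrite mem_iota => hv ->.
  left=> r rv; rewrite -/(xK i) e; apply/eqP.
  case: b {e}; rewrite ?(expr1, expr0, mulN1r, mul1r) => /eqP.
    rewrite eq_sym subr_eq addrC -subr_eq opprK -mulrnDr => /eqP/wK_inj; lia.
  by rewrite eq_sym subr_eq -mulrnDr => /eqP/wK_inj; lia.
right=> r rv; rewrite (rmorph_paircofactor _ phi) -/wK.
rewrite /paircofactor; set u0 := (if _ then _ else _).
have hf u (ua : (u < a)%N) : u != u0 -> (wK *+ (2 * v) - wK *+ (2 * u)) ^+ 2 = xK i ^+ 2 ->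
    \prod_(u < a | u != u0 :> nat) ((wK *+ (2 * v) - wK *+ (2 * u)) ^+ 2 - phi (x i) ^+ 2) = 0.
  by move=> uu0 eu; rewrite (bigD1 (Ordinal ua)) //= eu subrr mul0r.
have [s0|s0] := posnP s.
  have x0 : xK i = 0 by rewrite e s0 muln0 mulr0n mulr0.
  have [vu0|vu0] := eqVneq v u0.
    have -> : r = v by move: vu0; rewrite /u0; case: ifP => ?; lia.
    by rewrite -/(xK i) x0 subrr addr0 oppr0 !mul0r.
  by rewrite (hf v) ?mulr0 ?mul0r //; [lia|rewrite subrr x0].
have [vu0|vu0] := eqVneq (v + s)%N u0.
  rewrite (hf (v - s)%N) ?mulr0 ?mul0r //; [lia|lia|].
  by rewrite -e2; have -> : v = (s + (v - s))%N; [lia|rewrite addKn; ring].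
rewrite (hf (v + s)%N) ?mulr0 ?mul0r //; first lia.
by rewrite -e2; ring.
Qed.

End Conditions.

(** * Integrality at z = 0 *)

Lemma taylor2 (S : comNzRingType) (p : {poly S}) (z : S) :
  exists q, (p \Po ('X + z%:P)) = p + z *: p^`() + z ^+ 2 *: q.
Proof.
elim/poly_ind: p => [|p c [q IH]].
  by exists 0; rewrite comp_poly0 deriv0 !scaler0 !addr0.
exists (q * ('X + z%:P) + p^`()).
rewrite comp_polyD comp_polyM comp_polyX comp_polyC IH derivD derivM derivX derivC.
by rewrite -!mul_polyC !polyC_exp; ring.
Qed.

Lemma scale_poly_inj (S : idomainType) (c : S) :
  c != 0 -> injective (fun p : {poly S} => c *: p).
Proof.
by move=> c0 p q; rewrite /= -!mul_polyC; apply: mulfI; rewrite polyC_eq0.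
Qed.

Section Integrality.
Variables (S : idomainType) (w : S) (eps : {rmorphism S -> S}).
Hypothesis S0 : forall k, (k.+1%:R : S) != 0.
Hypothesis w0 : w != 0.
Hypothesis eps_w : eps w = 0.
Hypothesis eps_ker : forall s, eps s = 0 -> exists t, s = w * t.
Local Notation z := (w *+ 2).
Local Notation red p := (map_poly eps p).

Lemma red_eq0 (p : {poly S}) : red p = 0 -> exists q, p = w *: q.
Proof.
elim/poly_ind: p => [|p c IH]; first by exists 0; rewrite scaler0.
rewrite rmorphD rmorphM /= map_polyX map_polyC => e.
have /eps_ker[t ->] : eps c = 0.
  by have := congr1 (fun p : {poly S} => p`_0) e; rewrite coefD coefMX coefC eqxx add0r coef0.
have /IH[q ->] : red p = 0.
  apply/polyP => i; have := congr1 (fun p : {poly S} => p`_i.+1) e.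
  by rewrite coefD coefMX coefC /= addr0 !coef0.
by exists (q * 'X + t%:P); rewrite scalerDr scalerAl -[w *: t%:P]mul_polyC polyCM.
Qed.

Lemma eqn_natr_S p q : ((p%:R : S) == q%:R) = (p == q).
Proof.
wlog le_pq : p q / (p <= q)%N => [H|].
  by have /orP[/H|/H] := leq_total p q; rewrite // eq_sym [RHS]eq_sym.
case: ltngtP le_pq => // [pq _|-> _]; last by rewrite eqxx.
rewrite -subr_eq0 -opprB oppr_eq0 -natrB ?(ltnW pq) //.
by apply/negbTE; rewrite -(prednK (n := q - p)) ?subn_gt0 // S0.
Qed.

Lemma euler_kernel (p : {poly S}) e :
  p^`() * 'X = p *+ e -> (p \Po (- 'X)) * 'X^e = - p * (- 'X) ^+ e -> p = 0.
Proof.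
move=> h1 h2.
have hr r : r != e -> p`_r = 0.
  move=> re; have := congr1 (fun q : {poly S} => q`_r) h1; rewrite coefMX coefMn coef_deriv.
  case: r re => [|r] re /=.
    by move/esym/eqP; rewrite -mulr_natr mulf_eq0 (eqn_natr_S e 0) (eq_sym e) (negPf re) orbF => /eqP.
  move/eqP; rewrite -subr_eq0 -mulr_natr -[_ *+ e]mulr_natr -mulrBr mulf_eq0 subr_eq0 eqn_natr_S.
  by rewrite (negPf re) orbF => /eqP.
have pE : p = p`_e *: 'X^e.
  apply/polyP => r; rewrite coefZ coefXn; case: eqVneq => [->|/hr ->]; first by rewrite mulr1.
  by rewrite mulr0.
move: h2; rewrite pE comp_polyZ comp_Xn_poly => /eqP.
rewrite -subr_eq0 mulNr opprK -!scalerAl [X in _ + _ *: X]mulrC -scalerDl -mul_polyC.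
rewrite mulf_eq0 polyC_eq0 -mulr2n -mulr_natr mulf_eq0 (negPf (S0 1)) orbF => /orP[/eqP ->|].
  by rewrite scale0r.
by rewrite mulf_eq0 !expf_eq0 oppr_eq0 polyX_eq0 !andbF.
Qed.

Variables (D W R : {poly S}) (e d : nat) (sgn u : S).
Hypothesis redD : red D = 'X^e.
Hypothesis redW : red W = sgn *: 'X^d.
Hypothesis sgn0 : sgn != 0.

Lemma shift_eq (N : {poly S}) k :
  W * ((N \Po ('X + z%:P)) * D - N * (D \Po ('X + z%:P))) = (z * u * w ^+ k) *: R ->
  sgn *: 'X^d * ((red N)^`() * 'X^e - red N * ('X^e)^`()) = (eps u * eps (w ^+ k)) *: red R.
Proof.
have [p pE] := taylor2 N z; have [q qE] := taylor2 D z.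
rewrite pE qE.
have -> : (N + z *: N^`() + z ^+ 2 *: p) * D - N * (D + z *: D^`() + z ^+ 2 *: q) =
   z *: (N^`() * D - N * D^`() + z *: (p * D - N * q)).
  by rewrite -!mul_polyC !polyC_exp; ring.
have z0 : z != 0 by rewrite -mulr_natr mulf_neq0.
rewrite -scalerAr -!mulrA -scalerA => /(scale_poly_inj z0) h.
have := congr1 (fun p : {poly S} => red p) h.
rewrite /= rmorphM /= map_polyZ rmorphD /= map_polyZ raddfMn /= eps_w mul0rn scale0r addr0.
by rewrite rmorphB !rmorphM /= -!deriv_map redD redW.
Qed.

(* Modulo [w] the difference equation becomes the one of [euler_kernel]. *)
Lemma integrality k (N : {poly S}) :
  (N \Po (- 'X)) * D = - N * (D \Po (- 'X)) ->
  W * ((N \Po ('X + z%:P)) * D - N * (D \Po ('X + z%:P))) = (z * u * w ^+ k) *: R ->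
  exists N2, [/\ N = w ^+ k *: N2, (N2 \Po (- 'X)) * D = - N2 * (D \Po (- 'X)) &
    W * ((N2 \Po ('X + z%:P)) * D - N2 * (D \Po ('X + z%:P))) = (z * u) *: R].
Proof.
elim: k N => [|k IH] N hodd heq.
  by exists N; rewrite expr0 scale1r; split=> //; rewrite heq expr0 mulr1.
have h0 := shift_eq heq.
have /red_eq0[N1 NE] : red N = 0.
  apply: (@euler_kernel _ e).
    move/eqP: h0; rewrite exprS rmorphM eps_w mul0r mulr0 scale0r -mul_polyC !mulf_eq0.
    rewrite polyC_eq0 (negPf sgn0) expf_eq0 polyX_eq0 andbF /= => /eqP h0.
    have : 'X^e * ((red N)^`() * 'X - red N *+ e) = 0.
      rewrite -[RHS](mulr0 'X) -[in RHS]h0 derivXn -mulr_natr -[_ *+ e]mulr_natr.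
      by case: (e) => [|e']; rewrite ?exprS /= ?mulr0n; ring.
    by move/eqP; rewrite mulf_eq0 expf_eq0 polyX_eq0 andbF /= subr_eq0 => /eqP.
  have := congr1 (fun p : {poly S} => red p) hodd; rewrite !rmorphM rmorphN /=.
  by rewrite !map_comp_poly rmorphN /= map_polyX redD comp_Xn_poly.
have [||N2 [N2E o2 e2]] := IH N1; last first.
- by exists N2; split=> //; rewrite NE N2E scalerA -exprS.
- apply: (scale_poly_inj w0); move: heq; rewrite NE comp_polyZ -!scalerAl -scalerBr -scalerAr => ->.
  by rewrite scalerA; congr (_ *: _); rewrite exprS; ring.
- apply: (scale_poly_inj w0); move: hodd; rewrite NE comp_polyZ -!scalerAl => ->.
  by rewrite -scalerN -!scalerAl.
Qed.

Lemma power_divides k (f g y : S) :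
  eps y != 0 -> y * f = w ^+ k * g -> exists f', f = w ^+ k * f'.
Proof.
move=> y0; elim: k f g => [|k IH] f g e1; first by exists f; rewrite mul1r.
have /eps_ker[f1 f1E] : eps f = 0.
  have := congr1 eps e1; rewrite !rmorphM exprS rmorphM eps_w !mul0r => /eqP.
  by rewrite mulf_eq0 (negPf y0) => /eqP.
have [|f' f'E] := IH f1 g.
  by apply: (mulfI w0); rewrite mulrCA -f1E e1 exprS mulrA.
by exists f'; rewrite f1E f'E exprS mulrA.
Qed.

End Integrality.

(** * Existence of the derivations over a domain *)

Lemma comp_poly_neq0 (S : idomainType) (p q r : {poly S}) :
  q \Po r = 'X -> p != 0 -> p \Po q != 0.
Proof.
move=> qr; apply: contra_neq => e.
by rewrite -[p]comp_polyXr -qr comp_polyA e comp_poly0.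
Qed.

Lemma map_poly_generic (S : idomainType) (p q : {poly S}) :
  (map_poly (@tofrac _ \o @polyC S) p).[tofrac q] = tofrac (p \Po q).
Proof. by rewrite map_poly_comp /= horner_map. Qed.

Lemma euler_shift (S : comNzRingType) (p : {poly S}) c d e :
  'X^(d + e) * (('X^c * p)^`() * 'X - 'X^c * p *+ (e + c)) =
  'X^d * (p^`() * 'X^e - p * ('X^e)^`()) * 'X^(c.+1).
Proof.
have dX m : ('X^m)^`() * 'X = 'X^m *+ m :> {poly S}.
  by rewrite derivXn; case: m => [|m] /=; rewrite ?mulr0n ?mul0r // exprSr mulrnAl.
transitivity ('X^(d + e) * (p * (('X^c)^`() * 'X) + 'X^c * p^`() * 'X - 'X^c * p *+ (e + c))).
  by rewrite derivM; ring.
transitivity ('X^d * 'X^c * (p^`() * 'X^e * 'X - p * (('X^e)^`() * 'X))).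
  by rewrite !dX exprD; ring.
by rewrite exprS; ring.
Qed.

Section Numerator.
Variables (S : idomainType) (l a n : nat) (w : S) (x : 'I_l -> S).
Variables (A : {poly S}) (beta : nat -> S).
Let z := w *+ 2.
Let Q := poles a n.
Let rho k := beta k * (zeroprod a n w (w *+ k) * pairprod a w x (w *+ k)).
Let lin k r : {poly S} := 'X - (w *+ k - w *+ (2 * r))%:P.

Definition commonden : {poly S} := \prod_(k <- Q) \prod_(r < k.+1) lin k r.

Definition numerator : {poly S} :=
  commonden * (A - (A \Po - 'X)) -
  z *: \sum_(k <- Q) rho k *: \sum_(r < k.+1)
    (\prod_(r' < k.+1 | r' != r) lin k r' *
     \prod_(k' <- Q | k' != k) \prod_(r' < k'.+1) lin k' r').

Lemma numerator_eval (K : fieldType) (phi : {rmorphism S -> K}) t :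
  (map_poly phi commonden).[t] != 0 ->
  (map_poly phi numerator).[t] =
  (map_poly phi commonden).[t] * Fhat a n w x A beta phi t.
Proof.
pose f : {rmorphism {poly S} -> K} := horner_eval t \o map_poly phi.
have fC u : f u%:P = phi u by rewrite /f /= map_polyC /horner_eval hornerC.
have fX : f 'X = t by rewrite /f /= map_polyX /horner_eval hornerX.
have fZ u p : f (u *: p) = phi u * f p by rewrite -mul_polyC rmorphM fC.
have fA : f (A \Po - 'X) = (map_poly phi A).[- t].
  rewrite /f /= /horner_eval map_comp_poly rmorphN /= map_polyX horner_comp.
  by rewrite hornerN hornerX.
have fE p : (map_poly phi p).[t] = f p by [].
rewrite /Fhat !fE -fA; clearbody f => D0.
rewrite /numerator rmorphB rmorphM rmorphB !fZ rmorph_sum [RHS]mulrBr; congr (_ * (_ - _) - _).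
rewrite mulrCA; congr (_ * _); rewrite mulr_sumr; apply: eq_big_seq => k kQ.
rewrite fZ rmorph_sum mulrCA; congr (_ * _); rewrite mulr_sumr; apply: eq_bigr => r _.
have DE : commonden = lin k r * (\prod_(r' < k.+1 | r' != r) lin k r' *
     \prod_(k' <- Q | k' != k) \prod_(r' < k'.+1) lin k' r').
  by rewrite /commonden (bigD1_seq k) ?poles_uniq //= (bigD1 r) //= mulrA.
have fl : f (lin k r) = t - (phi w *+ k - phi w *+ (2 * r)).
  by rewrite rmorphB fX fC rmorphB !rmorphMn.
move: D0; rewrite DE rmorphM fl mulf_eq0 negb_or => /andP[d0 _].
by rewrite mulrAC divff ?mul1r.
Qed.

End Numerator.

Section Existence.
Variables (S : idomainType) (l a n : nat) (w : S) (x : 'I_l -> S) (eps : {rmorphism S -> S}).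
Hypothesis hU : forall k, (k.+1%:R : S) \is a GRing.unit.
Hypothesis w0 : w != 0.
Hypothesis eps_w : eps w = 0.
Hypothesis eps_ker : forall s, eps s = 0 -> exists t, s = w * t.
Hypothesis eps_x : forall i, eps (x i) = x i.
Hypothesis x_nonint : forall i (c : int), x i != w *~ c.
Let z := w *+ 2.
Let Q := poles a n.
Let g : {poly S} := zeroprod a n w%:P 'X * pairprod a w%:P (fun k => (x k)%:P) 'X.
Let den : {poly S} := \prod_(k <- Q) ('X - (w *+ k)%:P).
Let D := commonden a n w.

Let S0 k : (k.+1%:R : S) != 0.
Proof. by apply: contraTneq (hU k) => ->; rewrite unitr0. Qed.

Let w_inj p q : (w *+ p == w *+ q) = (p == q).
Proof.
rewrite -subr_eq0 -mulr_natr -[w *+ q]mulr_natr -mulrBr mulf_eq0 (negPf w0) subr_eq0 /=.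
exact: eqn_natr_S.
Qed.

Lemma lagrange_poles : exists (C : int) k h beta, C != 0 /\
  (C%:~R * w ^+ k) *: g = den * h +
    \sum_(k <- Q) (beta k * (zeroprod a n w (w *+ k) * pairprod a w x (w *+ k))) *:
      \prod_(j <- Q | j != k) ('X - (w *+ j)%:P).
Proof.
have [|h [b]] := @lagrange_divisor _ [seq w *+ k | k <- Q] g.
  by rewrite map_inj_uniq ?poles_uniq // => p q /eqP; rewrite w_inj => /eqP.
rewrite !big_map /= => e.
have [C [k [C0 cE]]] : exists (C : int) k, C != 0 /\
    \prod_(j <- Q) \prod_(t <- [seq w *+ k | k <- Q] | t != w *+ j) (w *+ j - t)
    = C%:~R * w ^+ k.
  pose P (c : S) := exists (C : int) k, C != 0 /\ c = C%:~R * w ^+ k.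
  have P1 : P 1 by exists 1, 0%N; rewrite mulr1.
  have PM c d : P c -> P d -> P (c * d).
    move=> [C [k [C0 ->]]] [C' [k' [C0' ->]]]; exists (C * C'), (k + k')%N.
    by rewrite mulf_neq0 // intrM exprD; split=> //; ring.
  apply: (big_ind P) => // j _; rewrite big_map; apply: (big_ind P) => // t.
  rewrite w_inj => tj; exists (j%:Z - t%:Z), 1%N; split; first by rewrite subr_eq0 eqz_nat eq_sym.
  by rewrite expr1 rmorphB /= mulrBl !mulr_natl.
exists C, k, h, (fun j => b (w *+ j)); split=> //; rewrite -cE e; congr (_ * _ + _).
apply: eq_bigr => j _; congr (_ *: _).
  have -> : g.[w *+ j] = zeroprod a n w (w *+ j) * pairprod a w x (w *+ j); last by [].
  pose f : {rmorphism {poly S} -> S} := horner_eval (w *+ j).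
  have fC u : f u%:P = u by rewrite /f /= /horner_eval hornerC.
  have fX : f 'X = w *+ j by rewrite /f /= /horner_eval hornerX.
  rewrite -[LHS]/(f g) rmorphM (rmorph_zeroprod _ _ f) (rmorph_pairprod _ f) fX fC.
  by congr (_ * _); apply: eq_bigr => i _; apply: eq_bigr => u _; rewrite fC.
by rewrite big_map; apply: eq_bigl => t; rewrite w_inj.
Qed.


Let e := \sum_(k <- Q) k.+1.
Let q := size Q.
Let dn := (2 * n - a)%N.
Let refl : {poly S} := - z%:P - 'X.
Let den' := den \Po refl.
Let B : {poly S} := \prod_(k < l) ('X^2 - (x k ^+ 2)%:P) ^+ a.
Local Notation red p := (map_poly eps p).

Let eps_z : eps z = 0. Proof. by rewrite raddfMn /= eps_w mul0rn. Qed.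

Let redC c : red c%:P = (eps c)%:P.
Proof. exact: map_polyC. Qed.

Let red_lin c : eps c = 0 -> red ('X - c%:P) = 'X.
Proof.
by move=> ec; rewrite rmorphB /= map_polyX redC ec subr0.
Qed.

Lemma red_commonden : red D = 'X^e.
Proof.
rewrite /e expr_sum rmorph_prod; apply: eq_bigr => k _; rewrite rmorph_prod.
rewrite (eq_bigr (fun=> 'X)) ?prodr_const ?card_ord // => r _.
by rewrite /= red_lin // rmorphB !rmorphMn /= eps_w !mul0rn subrr.
Qed.

Lemma red_den : red den = 'X^q.
Proof.
rewrite rmorph_prod (eq_bigr (fun=> 'X)) => [|k _]; last first.
  by rewrite /= red_lin // raddfMn /= eps_w mul0rn.
by rewrite big_const_seq count_predT iter_mulr_1.
Qed.

Lemma red_refl p : red (p \Po refl) = red p \Po (- 'X).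
Proof. by rewrite map_comp_poly rmorphB rmorphN /= redC map_polyX eps_z oppr0 add0r. Qed.

Lemma red_g : red g = 'X^dn * B.
Proof.
rewrite rmorphM rmorph_zeroprod rmorph_pairprod /= !map_polyX !redC eps_w.
congr (_ * _).
  rewrite /zeroprod (eq_bigr (fun=> 'X)) ?prodr_const ?card_ord // => v _.
  by rewrite polyC0 !mul0rn addr0 subr0.
apply: eq_bigr => k _; rewrite (eq_bigr (fun=> 'X^2 - (x k ^+ 2)%:P)) => [|u _].
  by rewrite prodr_const card_ord.
by rewrite /= redC eps_x polyC0 mul0rn subr0 polyC_exp.
Qed.

Lemma B_even : B \Po (- 'X) = B.
Proof.
rewrite rmorph_prod; apply: eq_bigr => k _.
by rewrite rmorphXn rmorphB /= comp_Xn_poly comp_polyC sqrrN.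
Qed.

Lemma antiderivation_exists : exists (f : 'I_l -> S),
  [/\ forall (K : fieldType) (phi : {rmorphism S -> K}) i j (b b' : bool) s,
        phi w != 0 -> (forall c : int, phi (x j) <> phi w *~ c) -> (s <= a)%N ->
        (-1) ^+ b * phi (x i) = (-1) ^+ b' * phi (x j) + phi z *+ s ->
        (-1) ^+ b * phi (f i) = (-1) ^+ b' * phi (f j),
      forall (K : fieldType) (phi : {rmorphism S -> K}) i (b : bool) s,
        phi w != 0 -> (s <= n)%N -> phi (x i) = (-1) ^+ b * (phi z *+ s) ->
        phi (f i) = 0 &
      exists (E : nat) (N : {poly S}) (C : int), [/\ C != 0,
        forall i, eps (f i) * x i ^+ (E + 2 * a) = N.[x i],
        (N \Po - 'X) * 'X^(E + 2 * a) = - N * (- 'X) ^+ (E + 2 * a) &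
        N^`() * 'X - N *+ (E + 2 * a) = C%:~R *: ('X^(E + 1 + 2 * n) * B)]].
Proof.
have [C [k [h [beta [C0 hL]]]]] := lagrange_poles.
have [A hA] := antidifference z hU h.
pose N := numerator a n w x A beta.
pose f1 := antiderivative_at a n w x A beta.
have D_comp_neq0 (r r' : {poly S}) : r \Po r' = 'X -> D \Po r != 0.
  move=> rr; apply: (comp_poly_neq0 rr); apply/eqP => D0.
  have := red_commonden; rewrite D0 rmorph0 => /esym/eqP.
  by rewrite expf_eq0 polyX_eq0 andbF.
pose phi : {rmorphism S -> {fraction {poly S}}} := @tofrac _ \o @polyC S.
have hN (r r' : {poly S}) : r \Po r' = 'X ->
    tofrac (N \Po r) = tofrac (D \Po r) * Fhat a n w x A beta phi (tofrac r).
  move=> rr; rewrite -!map_poly_generic; apply: numerator_eval.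
  by rewrite map_poly_generic tofrac_eq0 (D_comp_neq0 _ r').
have hNx i : D.[x i] * f1 i = N.[x i].
  pose psi : {rmorphism S -> {fraction S}} := @tofrac S.
  have evx (p : {poly S}) : (map_poly psi p).[tofrac (x i)] = tofrac p.[x i].
    exact: horner_map.
  have x_ni : forall c : int, psi (x i) <> psi w *~ c.
    move=> c; rewrite -(rmorphMz psi) => /eqP.
    by rewrite tofrac_eq (negPf (x_nonint i c)).
  have Dx0 : (map_poly psi D).[tofrac (x i)] != 0.
    rewrite evx tofrac_eq0 horner_prod prodf_seq_neq0; apply/allP => j _ /=.
    rewrite horner_prod; apply/prodf_neq0 => r _; rewrite hornerXsubC subr_eq0.
    have := x_nonint i (j%:Z - (2 * r)%N%:Z); rewrite mulrzBr.
    by rewrite -!pmulrn.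
  have := @numerator_eval _ l a n w x A beta _ psi _ Dx0; rewrite !evx => e1.
  apply/eqP; rewrite -tofrac_eq e1 tofracM; apply/eqP; congr (_ * _).
  exact: antiderivative_eval_nonint x_ni.
have K0 (K : fieldType) (phi' : {rmorphism S -> K}) j : (j.+1%:R : K) != 0.
  by have := rmorph_unit phi' (hU j); rewrite unitfE rmorph_nat.
have f1_pair (K : fieldType) (psi : {rmorphism S -> K}) i j (b b' : bool) s :
    psi w != 0 -> (forall c : int, psi (x j) <> psi w *~ c) -> (s <= a)%N ->
    (-1) ^+ b * psi (x i) = (-1) ^+ b' * psi (x j) + psi z *+ s ->
    (-1) ^+ b * psi (f1 i) = (-1) ^+ b' * psi (f1 j).
  by move=> pw hx; apply: (antiderivative_pair hA hL).
have f1_zero (K : fieldType) (psi : {rmorphism S -> K}) i (b : bool) s :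
    psi w != 0 -> (s <= n)%N -> psi (x i) = (-1) ^+ b * (psi z *+ s) -> psi (f1 i) = 0.
  by move=> pw; apply: (antiderivative_zero hA hL (K0 _ psi) pw).
clearbody N f1.
have rX : 'X \Po 'X = 'X :> {poly S} by rewrite comp_polyX.
have rN : - 'X \Po - 'X = 'X :> {poly S} by rewrite rmorphN /= comp_polyX opprK.
have rz : ('X + z%:P) \Po ('X - z%:P) = 'X.
  by rewrite rmorphD /= comp_polyX comp_polyC subrK.
have Nodd : (N \Po - 'X) * D = - N * (D \Po - 'X).
  apply/eqP; rewrite -tofrac_eq !tofracM tofracN (hN _ _ rN) -[N]comp_polyXr (hN _ _ rX).
  by rewrite comp_polyXr [tofrac (- 'X)]tofracN Fhat_opp; apply/eqP; ring.
have phiC c : map_poly phi c%:P = (phi c)%:P by apply: map_polyC.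
have Gden (r : {poly S}) : (forall c : S, r != c%:P) ->
    tofrac (den \Po r) * Ghat a n w x h beta phi (tofrac r) =
    phi (C%:~R * w ^+ k) * tofrac (g \Po r).
  move=> rc; have np j : j \in Q -> tofrac r != phi w *+ j.
    by move=> _; rewrite -(rmorphMn phi) /= tofrac_eq rc.
  have := Ghat_den hL np; rewrite -(evg a n w x phi) map_poly_generic => <-.
  congr (_ * _); rewrite -map_poly_generic rmorph_prod horner_prod.
  apply: eq_bigr => j _; rewrite rmorphB /= map_polyX phiC hornerXsubC; congr (_ - _).
  exact: (rmorphMn phi).
pose R := D * (D \Po ('X + z%:P)) * (den' * g + den * (g \Po refl)).
have X_neqC (c : S) : 'X != c%:P.
  by apply: contraTneq (leqnn (size ('X : {poly S}))) => {2}->; rewrite size_polyX size_polyC; case: (c != 0).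
have refl_neqC (c : S) : refl != c%:P.
  apply/eqP => rc; have := X_neqC (- z - c); rewrite polyCB polyCN -rc /refl.
  by rewrite (_ : _ - (_ - _) = 'X) ?eqxx //; ring.
have den_neq0 (r r' : {poly S}) : r \Po r' = 'X -> den \Po r != 0.
  move=> rr; apply: (comp_poly_neq0 rr); apply/eqP => d0.
  have := red_den; rewrite d0 rmorph0 => /esym/eqP.
  by rewrite expf_eq0 polyX_eq0 andbF.
have Neq : den * den' * ((N \Po ('X + z%:P)) * D - N * (D \Po ('X + z%:P))) =
    (z * C%:~R * w ^+ k) *: R.
  apply/eqP; rewrite -tofrac_eq -mul_polyC !(tofracM, tofracD, tofracB, tofracN).
  rewrite (hN _ _ rz) -[N]comp_polyXr (hN _ _ rX) comp_polyXr.
  have st := Fhat_step a n x beta hA phi (tofrac 'X).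
  have tz : tofrac ('X + z%:P) = tofrac 'X + phi z by rewrite tofracD.
  have tr : - phi z - tofrac 'X = tofrac refl by rewrite /refl tofracB tofracN.
  rewrite tr -tz in st.
  have := Gden 'X X_neqC; rewrite !comp_polyXr => G1.
  have := Gden refl refl_neqC; rewrite -/den' => G2.
  have phiE c : tofrac c%:P = phi c by [].
  have zE : phi (z * C%:~R * w ^+ k) = phi z * phi (C%:~R * w ^+ k).
    by rewrite -(rmorphM phi) mulrA.
  rewrite !phiE zE; apply/eqP.
  transitivity (tofrac D * tofrac (D \Po ('X + z%:P)) * tofrac den * tofrac den' *
    (Fhat a n w x A beta phi (tofrac ('X + z%:P)) - Fhat a n w x A beta phi (tofrac 'X))).
    ring.
  rewrite st.
  transitivity (phi z * (tofrac D * tofrac (D \Po ('X + z%:P))) *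
    (tofrac den' * (tofrac den * Ghat a n w x h beta phi (tofrac 'X)) +
     tofrac den * (tofrac den' * Ghat a n w x h beta phi (tofrac refl)))).
    ring.
  by rewrite G1 G2 /R !(tofracM, tofracD); ring.
have redW : red (den * den') = ((-1) ^+ q) *: 'X^(q + q).
  rewrite rmorphM /= red_refl red_den comp_Xn_poly (exprNn 'X) -mul_polyC exprD.
  by rewrite polyC_exp polyCN; ring.
have sgn0 : (-1) ^+ q != 0 :> S by rewrite signr_eq0.
have [N2 [NE N2odd N2eq]] :=
  integrality S0 w0 eps_w eps_ker red_commonden redW sgn0 Nodd Neq.
have eps_D i : eps D.[x i] = x i ^+ e.
  by rewrite -horner_map eps_x -/(red D) red_commonden hornerXn.
have x0 i : x i != 0 by have := x_nonint i 0; rewrite mulr0z.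
have /fin_all_exists[f fE] i : exists f, f1 i = w ^+ k * f.
  apply: (power_divides w0 eps_w eps_ker (y := D.[x i]) (g := N2.[x i])).
    by rewrite eps_D expf_neq0.
  by rewrite hNx NE hornerZ.
exists f; split.
- move=> K psi i j b b' s pw hx sa ex; have := f1_pair K psi i j b b' s pw hx sa ex.
  rewrite !fE !rmorphM /= rmorphXn /= => e1.
  have : psi w ^+ k != 0 by rewrite expf_neq0.
  by move/mulfI; apply; rewrite mulrCA e1 mulrCA.
- move=> K psi i b s pw sn ex; have := f1_zero K psi i b s pw sn ex.
  rewrite fE rmorphM rmorphXn /= => /eqP; rewrite mulf_eq0 expf_eq0 (negPf pw) andbF /=.
  by move/eqP.
exists e, ('X^(2 * a) * red N2), (C * 2); split.
- by rewrite mulf_neq0.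
- move=> i; have : D.[x i] * f i = N2.[x i].
    have : w ^+ k != 0 by rewrite expf_neq0.
    by move/mulfI; apply; rewrite mulrCA -fE hNx NE hornerZ.
  move/(congr1 eps); rewrite rmorphM eps_D -horner_map eps_x => e1.
  by rewrite hornerM hornerXn -e1 exprD; ring.
- have e1 := congr1 (fun p : {poly S} => red p) N2odd.
  rewrite !rmorphM rmorphN /= !map_comp_poly rmorphN /= map_polyX in e1.
  rewrite red_commonden comp_Xn_poly in e1.
  rewrite comp_polyM comp_Xn_poly !(exprD _ e).
  transitivity ((- 'X) ^+ (2 * a) * 'X^(2 * a) * ((red N2 \Po - 'X) * 'X^e)); first ring.
  by rewrite e1; ring.
have N2eq' : den * den' * ((N2 \Po ('X + z%:P)) * D - N2 * (D \Po ('X + z%:P))) =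
    (w *+ 2 * C%:~R * w ^+ 0) *: R by rewrite N2eq expr0 mulr1.
have := shift_eq S0 w0 eps_w red_commonden redW N2eq'.
have redR : red R = 'X^e * 'X^e * ((- 'X) ^+ q * ('X^dn * B) + 'X^q * ((- 'X) ^+ dn * B)).
  have mM r s : red (r * s) = red r * red s by rewrite rmorphM.
  have mD r s : red (r + s) = red r + red s by rewrite rmorphD.
  rewrite /R /den' (mM (D * _)) (mM D) mD (mM _ g) (mM den) !red_refl red_commonden red_den red_g.
  rewrite map_comp_poly rmorphD /= map_polyX redC eps_z polyC0 addr0 red_commonden comp_polyXr.
  by rewrite comp_polyM !comp_Xn_poly B_even.
rewrite redR expr0 !rmorph1 mulr1 rmorph_int.
have sgn_dn : (- 'X) ^+ dn = (-1) ^+ q * 'X^dn :> {poly S}.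
  rewrite (exprNn 'X); congr (_ * _); rewrite -[LHS]signr_odd -[RHS]signr_odd.
  by rewrite (_ : odd dn = odd q) // /q size_poles /dn; lia.
rewrite sgn_dn [(- 'X) ^+ q](exprNn 'X) => e1.
have e2 : 'X^(q + q) * ((red N2)^`() * 'X^e - red N2 * ('X^e)^`()) =
    (C * 2)%:~R *: ('X^e * 'X^e * ('X^dn * 'X^q) * B).
  apply: (scale_poly_inj sgn0); rewrite scalerAl e1 scalerA -!mul_polyC.
  by rewrite polyCM polyC_exp polyCN !rmorphM /=; ring.
have X0 m : 'X^m != 0 :> {poly S} by rewrite expf_eq0 polyX_eq0 andbF.
apply: (mulfI (X0 (q + q + e)%N)).
transitivity ('X^(q + q) * ((red N2)^`() * 'X^e - red N2 * ('X^e)^`()) * 'X^((2 * a).+1)).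
  exact: euler_shift.
have e3 : 'X^e * 'X^e * ('X^dn * 'X^q) * B * 'X^((2 * a).+1) =
    'X^(q + q + e) * ('X^(e + 1 + 2 * n) * B).
  have -> : (q = a + (a - 2 * n))%N by rewrite /q size_poles.
  rewrite mulrAC [RHS]mulrA -!exprD; congr (_ * _); congr ('X^_); rewrite /dn; lia.
by rewrite e2 -scalerAl e3 scalerAr.
Qed.

End Existence.

(** * Independence of the leading terms *)

Lemma coef_comp_oppX (S : comNzRingType) (p : {poly S}) r : (p \Po - 'X)`_r = (-1) ^+ r * p`_r.
Proof.
elim/poly_ind: p r => [|p c IH] r; first by rewrite comp_poly0 !coef0 mulr0.
rewrite comp_polyD comp_polyM comp_polyX comp_polyC mulrN !coefD coefN !coefMX !coefC.
by case: r => [|r] /=; rewrite ?oppr0 ?mul1r // !addr0 IH exprS -!mulrA mulN1r.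
Qed.

Section EulerOperator.
Variable F : numFieldType.
Implicit Types p q M : {poly F}.

Definition euler_op (G : nat) (p : {poly F}) : {poly F} := p^`() * 'X - p *+ G.

Lemma coef_euler_op G p r : (euler_op G p)`_r = p`_r * (r%:R - G%:R).
Proof.
rewrite coefB coefMX coefMn coef_deriv mulrBr !mulr_natr.
by case: r => [|r] //=; rewrite mulr0n.
Qed.

Lemma euler_op_XnM G d p : euler_op (d + G) ('X^d * p) = 'X^d * euler_op G p.
Proof.
rewrite /euler_op.
have dX : ('X^d)^`() * 'X = 'X^d *+ d :> {poly F}.
  by rewrite derivXn; case: (d) => [|m] /=; rewrite ?mulr0n ?mul0r // exprSr mulrnAl.
transitivity (p * (('X^d)^`() * 'X) + 'X^d * p^`() * 'X - 'X^d * p *+ (d + G)).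
  by rewrite derivM; ring.
by rewrite dX; ring.
Qed.

Lemma euler_opZ G c p : euler_op G (c *: p) = c *: euler_op G p.
Proof. by rewrite /euler_op derivZ -!mul_polyC; ring. Qed.

Lemma euler_op_sum G (I : finType) (f : I -> {poly F}) :
  euler_op G (\sum_i f i) = \sum_i euler_op G (f i).
Proof. by rewrite /euler_op raddf_sum mulr_suml -sumrMnl -sumrB. Qed.

Lemma euler_op_root G M y a V :
  y != 0 -> M.[y] = 0 -> euler_op G M = ('X - y%:P) ^+ a * V ->
  ('X - y%:P) ^+ a.+1 %| M.
Proof.
move=> y0 My hM; suff H b : (b <= a)%N -> ('X - y%:P) ^+ b.+1 %| M by apply: H.
elim: b => [|b IH] ba; first by rewrite expr1 dvdp_XsubCl /root My.
have /dvdpP[U UE] := IH (ltnW ba).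
suff : root U y.
  by rewrite -dvdp_XsubCl => /dvdpP[U' U'E]; rewrite UE U'E -mulrA -exprS dvdp_mulIr.
have e : b.+1%:R * y * U.[y] = 0.
  have : ('X - y%:P) ^+ b * (b.+1%:R%:P * 'X * U + ('X - y%:P) * (U^`() * 'X - U *+ G)) =
     ('X - y%:P) ^+ b * (('X - y%:P) ^+ (a - b) * V).
    rewrite mulrA -exprD subnKC ?(ltnW ba) // -hM UE /euler_op derivM deriv_exp derivXsubC /=.
    by rewrite polyC_natr exprS; ring.
  move/mulfI; rewrite expf_neq0 ?polyXsubC_eq0 // => /(_ isT) /(congr1 (horner^~ y)).
  rewrite hornerD !hornerM !hornerXsubC horner_exp hornerXsubC hornerC hornerX subrr.
  by rewrite expr0n subn_eq0 leqNgt ba /= !mul0r addr0.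
by move/eqP: e; rewrite !mulf_eq0 pnatr_eq0 (negPf y0) /=.
Qed.

Lemma prod_XsubC_exp_dvd k (s : seq F) p :
  uniq s -> {in s, forall y, ('X - y%:P) ^+ k %| p} ->
  \prod_(y <- s) ('X - y%:P) ^+ k %| p.
Proof.
elim: s => [|y s IH] /=; first by rewrite big_nil dvd1p.
case/andP=> ys us hp; rewrite big_cons Gauss_dvdp.
  by rewrite hp ?mem_head //= IH // => t ts; apply: hp; rewrite inE ts orbT.
rewrite coprimep_expl // coprimep_sym coprimep_XsubC /root horner_prod prodf_seq_eq0.
apply/hasPn => t ts /=; rewrite horner_exp hornerXsubC expf_eq0 subr_eq0 negb_and.
by apply/orP; right; apply: contraNneq ys => ->.
Qed.

End EulerOperator.

Section Independence.
Variables (R : numFieldType) (l a m : nat) (y : 'I_l -> R).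
Hypothesis y_gt0 : forall i, 0 < y i.
Hypothesis y_inj : injective y.
Let B : {poly R} := \prod_(k < l) ('X^2 - (y k ^+ 2)%:P) ^+ a.
Variables (E : 'I_l -> nat) (N : 'I_l -> {poly R}) (C : 'I_l -> R) (f : 'I_l -> 'I_l -> R).
Hypothesis C0 : forall j, C j != 0.
Hypothesis fN : forall j i, f j i * y i ^+ (E j + 2 * a) = (N j).[y i].
Hypothesis Nodd : forall j,
  (N j \Po - 'X) * 'X^(E j + 2 * a) = - N j * (- 'X) ^+ (E j + 2 * a).
Hypothesis Node : forall j, (N j)^`() * 'X - N j *+ (E j + 2 * a) =
  C j *: ('X^(E j + 1 + 2 * (m + j)) * B).

(* A dependency yields a solution [M] of an Euler equation vanishing at all [+- y_i], hence to
   order [a + 1] there, and its degree is too small for this. *)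
Lemma euler_independence (v : 'I_l -> R) :
  (forall i, \sum_j v j * f j i = 0) -> forall j, v j = 0.
Proof.
move=> hv.
pose e := (\sum_j E j)%N; pose G := (e + 2 * a)%N; pose o := (e + 1 + 2 * m)%N.
have Ee j : (E j <= e)%N by rewrite /e (bigD1 j) //= leq_addr.
pose M := \sum_j v j *: ('X^(e - E j) * N j).
pose q : {poly R} := \sum_j (v j * C j) *: 'X^(2 * j).
have Mode : euler_op G M = 'X^o * q * B.
  rewrite euler_op_sum mulr_sumr mulr_suml; apply: eq_bigr => j _.
  have -> : G = (e - E j + (E j + 2 * a))%N by rewrite /G addnA subnK.
  rewrite euler_opZ euler_op_XnM [euler_op _ _]Node -!mul_polyC polyCM.
  have eX : 'X^(e - E j) * 'X^(E j + 1 + 2 * (m + j)) = 'X^o * 'X^(2 * j) :> {poly R}.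
    by rewrite -!exprD; congr ('X^_); rewrite /o; have := Ee j; lia.
  transitivity ((v j)%:P * (C j)%:P * B * ('X^(e - E j) * 'X^(E j + 1 + 2 * (m + j)))).
    by ring.
  by rewrite eX; ring.
have Modd : M \Po - 'X = - (-1) ^+ G *: M.
  have XG : 'X^G != 0 :> {poly R} by rewrite expf_eq0 polyX_eq0 andbF.
  apply: (mulIf XG); rewrite -mul_polyC polyCN polyC_exp polyCN.
  transitivity (- M * (- 'X) ^+ G); last by rewrite (exprNn 'X); ring.
  rewrite rmorph_sum !mulr_suml -sumrN mulr_suml; apply: eq_bigr => j _ /=.
  have -> : G = (e - E j + (E j + 2 * a))%N by rewrite /G addnA subnK.
  rewrite comp_polyZ comp_polyM comp_Xn_poly -!mul_polyC !(exprD _ (e - E j)).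
  transitivity ((v j)%:P * (- 'X) ^+ (e - E j) * 'X^(e - E j) *
     ((N j \Po - 'X) * 'X^(E j + 2 * a))); first ring.
  by rewrite Nodd; ring.
have MG : M`_G = 0.
  have /(congr1 (fun p : {poly R} => p`_G)) := Modd.
  rewrite coef_comp_oppX coefZ mulNr => /eqP; rewrite -subr_eq0 opprK -mulr2n -mulr_natr.
  by rewrite !mulf_eq0 signr_eq0 pnatr_eq0 orbF => /eqP.
have My i : M.[y i] = 0.
  rewrite horner_sum -[RHS](mulr0 (y i ^+ G)) -[in RHS](hv i) mulr_sumr; apply: eq_bigr => j _.
  have -> : G = (e - E j + (E j + 2 * a))%N by rewrite /G addnA subnK.
  by rewrite hornerZ hornerM hornerXn -fN (exprD _ (e - E j)); ring.
have MNy i : M.[- y i] = 0.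
  have /(congr1 (horner^~ (y i))) := Modd.
  by rewrite horner_comp hornerN hornerX hornerZ My mulr0.
pose s := [seq y i | i <- enum 'I_l] ++ [seq - y i | i <- enum 'I_l].
have us : uniq s.
  have Ny_inj : injective (fun i => - y i) by move=> i j /oppr_inj/y_inj.
  rewrite cat_uniq (map_inj_uniq y_inj) (map_inj_uniq Ny_inj) enum_uniq andbT /=.
  apply/hasPn => _ /mapP[i _ ->]; apply/mapP => -[j _] e1.
  by have := y_gt0 j; rewrite -e1 oppr_gt0 lt_gtF ?y_gt0.
have BE : B = \prod_(t <- s) ('X - t%:P) ^+ a.
  rewrite big_cat !big_map /= -big_split; apply: eq_bigr => i _ /=.
  by rewrite -exprMn polyCN polyC_exp; congr (_ ^+ _); ring.
have [M0|M0] := eqVneq M 0; last first.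
  have [/eqP e0|e0] := eqVneq (euler_op G M) 0.
    move=> j; apply/eqP; case/negP: M0; apply/eqP/polyP => r; rewrite coef0.
    have [->//|rG] := eqVneq r G.
    have := congr1 (fun p : {poly R} => p`_r) (eqP e0); rewrite coef_euler_op coef0 => /eqP.
    by rewrite mulf_eq0 subr_eq0 eqr_nat (negPf rG) orbF => /eqP.
  have d1 : \prod_(t <- s) ('X - t%:P) ^+ a.+1 %| M.
    apply: (prod_XsubC_exp_dvd us) => t ts.
    have [t0 Mt] : t != 0 /\ M.[t] = 0.
      move: ts; rewrite mem_cat => /orP[] /mapP[i _ ->]; rewrite ?oppr_eq0; split=> //;
        by rewrite gt_eqF.
    apply: (@euler_op_root _ G _ _ _ ('X^o * q * \prod_(t' <- s | t' != t) ('X - t'%:P) ^+ a) t0 Mt).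
    by rewrite Mode BE (bigD1_seq t) //=; ring.
  have d2 : 'X^o %| M.
    have hr r : (r < o)%N -> M`_r = 0.
      move=> ro; have [->//|rG] := eqVneq r G.
      have := congr1 (fun p : {poly R} => p`_r) Mode.
      rewrite coef_euler_op -mulrA coefXnM ro => /eqP.
      by rewrite mulf_eq0 subr_eq0 eqr_nat (negPf rG) orbF => /eqP.
    apply/dvdpP; exists (drop_poly o M).
    rewrite -{1}[M](poly_take_drop o) (_ : take_poly o M = 0) ?add0r //.
    by apply/polyP => r; rewrite coef_take_poly coef0; case: ifP => // /hr.
  have d3 : 'X^o * \prod_(t <- s) ('X - t%:P) ^+ a.+1 %| M.
    rewrite Gauss_dvdp ?d1 ?d2 //; apply: coprimep_expl.
    rewrite -{1}['X]subr0 -{1}polyC0 coprimep_sym coprimep_XsubC.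
    rewrite /root horner_prod prodf_seq_eq0; apply/hasPn => t ts /=.
    rewrite horner_exp hornerXsubC expf_eq0 sub0r oppr_eq0 /=.
    move: ts; rewrite mem_cat => /orP[] /mapP[i _ ->]; rewrite ?oppr_eq0;
      by rewrite gt_eqF.
  have ss : size s = (2 * l)%N.
    by rewrite size_cat !size_map -enumT size_enum_ord mul2n addnn.
  have szprod b : size (\prod_(t <- s) ('X - t%:P) ^+ b) = (2 * l * b).+1.
    rewrite -ss; elim: (s) => [|t s' IH]; first by rewrite big_nil size_poly1.
    rewrite big_cons size_Mmonic ?monic_prod ?expf_neq0 ?polyXsubC_eq0 //.
      by rewrite IH size_exp_XsubC /= mulSn addnS.
    by move=> i _; rewrite monic_exp ?monicXsubC.
  have := dvdp_leq M0 d3; rewrite size_mul ?expf_neq0 ?polyX_eq0 //; last first.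
    by rewrite -size_poly_eq0 szprod.
  rewrite szprod size_polyXn /= => sM.
  have : (size M <= size (euler_op G M))%N.
    apply/leq_sizeP => r hr; have [->//|rG] := eqVneq r G.
    have := coef_euler_op G M r; rewrite nth_default // => /esym/eqP.
    by rewrite mulf_eq0 subr_eq0 eqr_nat (negPf rG) orbF => /eqP.
  have sq : (size q <= (2 * l).-1)%N.
    apply: (leq_trans (size_sum _ _ _)); apply/bigmax_leqP => j _.
    apply: (leq_trans (size_scale_leq _ _)); rewrite size_polyXn.
    by have := ltn_ord j; lia.
  have sB : size B = (2 * l * a).+1 by rewrite BE szprod.
  have q0 : q != 0 by apply: contraNneq e0 => q0; rewrite Mode q0 mulr0 mul0r.
  have B0 : B != 0 by rewrite -size_poly_eq0 sB.
  rewrite Mode size_mul ?mulf_neq0 ?expf_neq0 ?polyX_eq0 // size_mul ?expf_neq0 ?polyX_eq0 //.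
  rewrite size_polyXn sB; have : (0 < size q)%N by rewrite size_poly_gt0.
  have eS : (2 * l * a.+1 = 2 * l * a + 2 * l)%N by rewrite mulnS addnC.
  by move: sM sq; rewrite eS; move: (2 * l * a)%N (size q) (size M) => t1 t2 t3; lia.
have q0 : q = 0.
  have /eqP := Mode; rewrite M0 /euler_op deriv0 mul0r mul0rn subrr eq_sym !mulf_eq0.
  rewrite expf_eq0 polyX_eq0 andbF /= => /orP[/eqP//|].
  rewrite BE prodf_seq_eq0 => /hasP[t _] /=.
  by rewrite expf_eq0 polyXsubC_eq0 andbF.
move=> j; have /(congr1 (fun p : {poly R} => p`_(2 * j))) := q0.
rewrite coef_sum (bigD1 j) //= coefZ coefXn eqxx mulr1 big1 => [|i ij].
  by rewrite addr0 coef0 => /eqP; rewrite mulf_eq0 (negPf (C0 j)) orbF => /eqP.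
rewrite coefZ coefXn (_ : (2 * j == 2 * i)%N = false) ?mulr0 //.
by apply/negbTE; apply: contra_neq ij => /eqP; rewrite eqn_pmul2l // => /eqP/val_inj.
Qed.

End Independence.

(** * Linear forms and Saito's criterion *)

Definition divides (S : comNzRingType) (d f : S) := exists q, f = d * q.

Section Substitution.
Variables (R : fieldType) (n : nat).
Local Notation S := {mpoly R[n]}.

Lemma mpoly_closed_ind (P : S -> Prop) :
  P 1 -> (forall i, P 'X_i) -> (forall p q, P p -> P q -> P (p * q)) ->
  (forall p q, P p -> P q -> P (p + q)) -> (forall c p, P p -> P (c *: p)) ->
  forall p, P p.
Proof.
move=> P1 PX PM PD PZ.
have PE m : P 'X_[m].
  rewrite mpolyXE_id; apply: (big_ind P) => // i _.
  by elim: (m i) => [|k IH]; rewrite ?expr0 ?exprS //; apply: PM.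
elim/mpolyind => [|c m p _ _ Pp]; first by rewrite -(scale0r 1); apply: PZ.
by apply: PD => //; apply: PZ.
Qed.

Definition substvar (i : 'I_n) (e : S) : {rmorphism S -> S} :=
  mmap (@mpolyC n R) (fun j => if j == i then e else 'X_j).

Lemma substvarX i e j : substvar i e 'X_j = if j == i then e else 'X_j.
Proof. by rewrite /= mmapX mmap1U. Qed.

Lemma substvarZ i e c p : substvar i e (c *: p) = c *: substvar i e p.
Proof. by rewrite /= mmapZ mul_mpolyC. Qed.

Lemma substvar_congr i e f : divides ('X_i - e) (f - substvar i e f).
Proof.
elim/mpoly_closed_ind: f => [|j|p q [r rE] [s sE]|p q [r rE] [s sE]|c p [r rE]].
- by exists 0; rewrite rmorph1 subrr mulr0.
- rewrite substvarX; case: eqP => [->|_]; first by exists 1; rewrite mulr1.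
  by exists 0; rewrite subrr mulr0.
- exists (r * q + substvar i e p * s); rewrite rmorphM.
  transitivity ((p - substvar i e p) * q + substvar i e p * (q - substvar i e q)).
    by ring.
  by rewrite rE sE; ring.
- exists (r + s); rewrite rmorphD mulrDr -rE -sE; ring.
- by exists (c *: r); rewrite substvarZ -scalerBr rE scalerAr.
Qed.

Lemma substvar_ker i e f : substvar i e f = 0 -> divides ('X_i - e) f.
Proof. by move=> f0; have := substvar_congr i e f; rewrite f0 subr0. Qed.

End Substitution.

Section PrimeProduct.
Variable S : idomainType.

Definition prime_elt (p : S) := p != 0 /\
  forall f g, divides p (f * g) -> divides p f \/ divides p g.

Lemma prime_prod_divides (s : seq S) f :
  uniq s -> {in s, forall p, prime_elt p} ->
  {in s &, forall p q, p != q -> ~ divides p q} ->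
  {in s, forall p, divides p f} -> divides (\prod_(p <- s) p) f.
Proof.
elim: s f => [|p s IH] f /=; first by exists f; rewrite big_nil mul1r.
case/andP=> ps us hp hpq hf.
have [g gE] := hf p (mem_head _ _).
have [|q r qs rs|q qs|h hE] := IH g us.
- by move=> q qs; apply: hp; rewrite inE qs orbT.
- by apply: hpq; rewrite inE ?qs ?rs orbT.
- have qs' : q \in p :: s by rewrite inE qs orbT.
  have := hf q qs'; rewrite gE => /(hp q qs').2[] // qp.
  case: (hpq q p qs' (mem_head _ _) _ qp).
  by apply: contraNneq ps => <-.
by exists h; rewrite big_cons gE hE mulrA.
Qed.

End PrimeProduct.

Section Saito.
Variables (S : idomainType) (n : nat).

Lemma divides_det (M : 'M[S]_n) (v : 'cV[S]_n) (d : S) i0 :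
  v i0 0 \is a GRing.unit -> (forall i, divides d ((M *m v) i 0)) ->
  divides d (\det M).
Proof.
move=> vu hM; have /fin_all_exists[u uE] := hM.
exists ((\adj M *m (\col_i u i)) i0 0 / v i0 0).
apply: (mulIr vu); rewrite mulrA divrK //.
have : \det M *: v = \adj M *m (M *m v) by rewrite mulmxA mul_adj_mx mul_scalar_mx.
move/matrixP => /(_ i0 0); rewrite mxE => ->.
have -> : M *m v = d *: \col_i u i by apply/matrixP => i j; rewrite ord1 uE !mxE.
by rewrite -scalemxAr mxE.
Qed.

Definition replace_row (M : 'M[S]_n) (r : 'I_n) (y : 'rV[S]_n) : 'M[S]_n :=
  \matrix_(i, j) if i == r then y 0 j else M i j.

Lemma cramer_row (M : 'M[S]_n) (y : 'rV[S]_n) r :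
  (y *m \adj M) 0 r = \det (replace_row M r y).
Proof.
rewrite (expand_det_row _ r) mxE; apply: eq_bigr => j _.
rewrite !mxE eqxx; congr (_ * _); rewrite /cofactor; congr (_ * \det _).
by apply/matrixP => i k; rewrite !mxE eq_sym (negPf (neq_lift _ _)).
Qed.

Lemma cramer_combination (M : 'M[S]_n) (y : 'rV[S]_n) (Q k : S) :
  \det M = Q * k -> k \is a GRing.unit -> \det M != 0 ->
  (forall r, divides Q (\det (replace_row M r y))) ->
  exists f : 'rV[S]_n, y = f *m M.
Proof.
move=> detM ku det0 /fin_all_exists[u uE].
exists (k^-1 *: \row_r u r).
have Q0 : Q != 0 by apply: contraNneq det0; rewrite detM => ->; rewrite mul0r.
have h : y *m \adj M = Q *: \row_r u r.
  by apply/rowP => r; rewrite cramer_row uE !mxE.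
have : \det M *: y = Q *: (\row_r u r *m M).
  by rewrite scalemxAl -h -mulmxA mul_adj_mx mul_mx_scalar.
rewrite detM -scalerA => e.
have {}e : k *: y = \row_r u r *m M.
  apply/rowP => j; have /rowP/(_ j) := e.
  by rewrite [LHS]mxE [RHS]mxE => /(mulfI Q0).
by rewrite -scalemxAl -e scalerA mulVr // scale1r.
Qed.

End Saito.

Section LinearForms.
Variables (R : realType) (n : nat).
Local Notation S := {mpoly R[n]}.
Implicit Types c d : 'rV[R]_n.

Lemma linform_eval c (v : 'I_n -> R) : (linform c).@[v] = \sum_i c 0 i * v i.
Proof. by rewrite /linform rmorph_sum; apply: eq_bigr => i _ /=; rewrite mevalZ mevalXU. Qed.

Lemma linform_inj : injective (@linform R n).
Proof.
move=> c d e; apply/rowP => j; have := congr1 (meval (fun i => (i == j)%:R)) e.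
have evj u : \sum_i u 0 i * (i == j)%:R = u 0 j :> R.
  by rewrite (bigD1 j) //= eqxx mulr1 big1 ?addr0 // => i /negPf ->; rewrite mulr0.
by rewrite !linform_eval !evj.
Qed.

Lemma linformZ a c : linform (a *: c) = a *: linform c.
Proof. by rewrite /linform scaler_sumr; apply: eq_bigr => i _; rewrite mxE scalerA. Qed.

Lemma linformB c d : linform (c - d) = linform c - linform d.
Proof. by rewrite /linform -sumrB; apply: eq_bigr => i _; rewrite !mxE scalerBl. Qed.

Lemma linform_homog c : linform c \is 1.-homog.
Proof.
by apply: rpred_sum => i _; apply: dhomogZ; rewrite dhomogX /= mdeg1.
Qed.

Definition eliminate c (i : 'I_n) : {rmorphism S -> S} :=
  substvar i ('X_i - (c 0 i)^-1 *: linform c).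

Lemma eliminate_linform c i d : c 0 i != 0 ->
  eliminate c i (linform d) = linform (d - (d 0 i / c 0 i) *: c).
Proof.
move=> ci; rewrite linformB linformZ {1}/linform rmorph_sum.
have -> : (d 0 i / c 0 i) *: linform c =
    \sum_j if j == i then (d 0 i / c 0 i) *: linform c else 0.
  by rewrite -big_mkcond big_pred1_eq.
rewrite {1}/linform -sumrB; apply: eq_bigr => j _; rewrite substvarZ substvarX.
by case: eqP => [->|_]; rewrite ?subr0 // scalerBr scalerA.
Qed.

Lemma eliminateP c i f : c 0 i != 0 ->
  divides (linform c) f <-> eliminate c i f = 0.
Proof.
move=> ci; split=> [[q ->]|/substvar_ker].
  by rewrite rmorphM eliminate_linform // divff // scale1r subrr /linform big1 ?mul0r // => j _;
    rewrite mxE scale0r.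
rewrite opprB addrC subrK => -[q ->]; exists ((c 0 i)^-1 *: q).
by rewrite -scalerAl scalerAr.
Qed.

Lemma linform_eq0 c : (linform c == 0) = (c == 0).
Proof.
apply/eqP/eqP => [e|->]; last by rewrite /linform big1 // => i _; rewrite mxE scale0r.
by apply: linform_inj; rewrite e /linform big1 // => i _; rewrite mxE scale0r.
Qed.

Lemma linform_prime c : c != 0 -> prime_elt (linform c).
Proof.
move=> c0; split; first by rewrite linform_eq0.
have /rV0Pn[i ci] := c0.
move=> f g /(eliminateP _ ci); rewrite rmorphM => /eqP; rewrite mulf_eq0.
by case/orP=> /eqP /(eliminateP _ ci); [left|right].
Qed.

Lemma linform_divides c d : c != 0 -> divides (linform c) (linform d) ->
  exists a, d = a *: c.
Proof.
move=> /rV0Pn[i ci] /(eliminateP _ ci); rewrite eliminate_linform // => /eqP.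
by rewrite linform_eq0 subr_eq0 => /eqP ->; exists (d 0 i / c 0 i).
Qed.

Lemma mem_hyperplane c v : (v \in hyperplane c) = (v *m c^T == 0).
Proof. by rewrite memv_ker lfunE. Qed.

Lemma hyperplane_eq c d : d != 0 -> hyperplane c = hyperplane d -> exists a, c = a *: d.
Proof.
move=> /rV0Pn[i di] e; exists (c 0 i / d 0 i); apply/rowP => j.
have mulE (u : 'rV[R]_n) : ((d 0 i *: delta_mx 0 j - d 0 j *: delta_mx 0 i) *m u^T) 0 0 =
    d 0 i * u 0 j - d 0 j * u 0 i.
  have sumE (k : 'I_n) (t : R) : \sum_s t * (s == k)%:R * u 0 s = t * u 0 k.
    by rewrite (bigD1 k) //= eqxx mulr1 big1 ?addr0 // => s /negPf ->; rewrite mulr0 mul0r.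
  rewrite mxE -!sumE -sumrB; apply: eq_bigr => k _.
  by rewrite !mxE /= mulrBl.
have : (d 0 i *: delta_mx 0 j - d 0 j *: delta_mx 0 i : 'rV[R]_n) \in hyperplane c.
  rewrite e mem_hyperplane; apply/eqP/matrixP => a b; rewrite !ord1 mulE mxE.
  by rewrite mulrC subrr.
rewrite mem_hyperplane => /eqP/matrixP/(_ 0 0); rewrite mulE !mxE => /eqP.
by rewrite subr_eq0 => /eqP h; rewrite mulrAC -[_ * d 0 j]mulrC -h; field.
Qed.

Lemma hyperplaneZ a c : a != 0 -> hyperplane (a *: c) = hyperplane c.
Proof.
move=> a0; apply/vspaceP => v; rewrite !mem_hyperplane linearZ /= -scalemxAr.
by rewrite scaler_eq0 (negPf a0).
Qed.

Definition normalized c := exists i, c 0 i = 1 /\ forall j : 'I_n, (j < i)%N -> c 0 j = 0.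

Lemma normalized_neq0 c : normalized c -> c != 0.
Proof. by case=> i [ci _]; apply/rV0Pn; exists i; rewrite ci oner_eq0. Qed.

Lemma normalized_proportional c d a : normalized c -> normalized d -> d = a *: c -> d = c.
Proof.
move=> [i [ci hi]] [j [dj hj]] e.
have eE k : d 0 k = a * c 0 k by rewrite e mxE.
suff a1 : a = 1 by rewrite e a1 scale1r.
case: (ltngtP i j) => ij.
- have := dj; rewrite eE; have := hj _ ij; rewrite eE ci mulr1 => ->.
  by rewrite mul0r => /eqP; rewrite eq_sym oner_eq0.
- by have := dj; rewrite eE hi // mulr0 => /eqP; rewrite eq_sym oner_eq0.
by have := dj; rewrite -(ord_inj ij) eE ci mulr1.
Qed.

End LinearForms.

Section Homogeneous.
Variables (R : idomainType) (n : nat).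
Local Notation S := {mpoly R[n]}.

Lemma dhomog_bigprod (I : Type) (s : seq I) (p : I -> S) (d : I -> nat) :
  (forall i, p i \is (d i).-homog) ->
  \prod_(i <- s) p i \is (\sum_(i <- s) d i)%N.-homog.
Proof.
move=> hp; apply: (big_ind2 (fun (q : S) k => q \is k.-homog)) => //.
  exact: dhomog1.
by move=> q k q' k' hq hq'; apply: dhomogM.
Qed.

Lemma det_homog (M : 'M[S]_n) (d : 'I_n -> nat) :
  (forall i j, M i j \is (d i).-homog) -> \det M \is (\sum_i d i)%N.-homog.
Proof.
move=> hM; apply: rpred_sum => s _.
have := dhomog_bigprod (index_enum _) (fun i => hM i (s i)).
by case: (odd_perm s); rewrite ?expr0 ?expr1 ?mul1r ?mulN1r // rpredN.
Qed.

Lemma homog_msize_eq (p : S) d : p != 0 -> p \is d.-homog -> msize p = d.+1.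
Proof.
move=> p0 hp; have := dhomog_uniq p0 hp (dhomog_msize hp) => ->.
by rewrite prednK // lt0n mmeasure_poly_eq0.
Qed.

End Homogeneous.

Section SaitoCriterion.
Variables (R : realType) (n : nat).
Local Notation S := {mpoly R[n]}.
Variables (cs : seq 'rV[R]_n) (d : 'I_n -> nat) (M : 'M[S]_n).
Hypothesis cs_uniq : uniq cs.
Hypothesis cs_norm : {in cs, forall c, normalized c}.
Hypothesis M_homog : forall i j, M i j \is (d i).-homog.
Hypothesis M_div : forall i c, c \in cs -> divides (linform c) (\sum_j c 0 j *: M i j).
Hypothesis d_sum : (\sum_i d i)%N = size cs.
Hypothesis det0 : \det M != 0.

Let Q : S := \prod_(c <- cs) linform c.

Lemma divides_det_logder (N : 'M[S]_n) :
  (forall i c, c \in cs -> divides (linform c) (\sum_j c 0 j *: N i j)) ->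
  divides Q (\det N).
Proof.
move=> hN; rewrite /Q -(big_map (@linform R n) xpredT id).
apply: prime_prod_divides.
- by rewrite map_inj_uniq //; apply: linform_inj.
- by move=> _ /mapP[c cc ->]; apply/linform_prime/normalized_neq0/cs_norm.
- move=> _ _ /mapP[c cc ->] /mapP[c' cc' ->] cc0 /linform_divides.
  case=> [|t e]; first exact/normalized_neq0/cs_norm.
  by move: cc0; rewrite (normalized_proportional (cs_norm cc) (cs_norm cc') e) eqxx.
move=> _ /mapP[c cc ->]; have [i0 [ci _]] := cs_norm cc.
apply: (@divides_det _ _ N (\col_j (c 0 j)%:MP) _ i0); first by rewrite mxE ci rmorph1 unitr1.
move=> i; have [q qE] := hN i c cc; exists q; rewrite -qE mxE.
by apply: eq_bigr => j _; rewrite mxE mulrC mul_mpolyC.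
Qed.

Lemma Q_homog : Q \is (size cs).-homog.
Proof.
by have := dhomog_bigprod cs (fun c => linform_homog c); rewrite sum1_size.
Qed.

Lemma det_constant : exists2 k : S, k \is a GRing.unit & \det M = Q * k.
Proof.
have [k kE] := divides_det_logder M_div; exists k => //.
have [Q0 k0] : Q != 0 /\ k != 0.
  by apply/andP; rewrite -negb_or -mulf_eq0 -kE.
have sd : msize (\det M) = (size cs).+1.
  by apply: homog_msize_eq => //; rewrite -d_sum; apply: det_homog.
have := sd; rewrite kE msizeM // (homog_msize_eq Q0 Q_homog) addSn /= => sk.
have : msize k == 1%N by move/eqP: sk; rewrite -[X in _ == X]addn1 eqn_add2l.
case/msize_poly1P => c c0 ->; apply/unitrP; exists (c^-1)%:MP.
by rewrite -!mpolyCM mulVf ?mulfV.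
Qed.

Lemma saito_span (y : 'rV[S]_n) :
  (forall c, c \in cs -> divides (linform c) (\sum_j c 0 j *: y 0 j)) ->
  exists f : 'rV[S]_n, y = f *m M.
Proof.
move=> hy; have [k ku kE] := det_constant.
apply: (cramer_combination kE ku det0) => r; apply: divides_det_logder => i c cc.
have [->|ir] := eqVneq i r.
  have [q qE] := hy c cc; exists q; rewrite -qE; apply: eq_bigr => j _.
  by rewrite mxE eqxx.
have [q qE] := M_div i cc; exists q; rewrite -qE; apply: eq_bigr => j _.
by rewrite mxE (negPf ir).
Qed.

Lemma saito_free (f f' : 'rV[S]_n) : f *m M = f' *m M -> f = f'.
Proof.
move=> e; have := congr1 (fun u => u *m \adj M) e.
rewrite -!mulmxA mul_mx_adj !mul_mx_scalar => {}e; apply/rowP => i.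
by have /rowP/(_ i) := e; rewrite !mxE => /(mulfI det0).
Qed.

End SaitoCriterion.

Section Derivations.
Variables (R : realType) (n : nat).
Local Notation S := {mpoly R[n]}.

Definition vector_field (g : 'rV[S]_n) (p : S) : S := \sum_i g 0 i * p^`M(i).

Lemma vector_field_linear g : linear (vector_field g).
Proof.
move=> a p q; rewrite /vector_field scaler_sumr -big_split; apply: eq_bigr => i _ /=.
by rewrite mderivD mderivZ mulrDr scalerAr.
Qed.

HB.instance Definition _ g := GRing.isLinear.Build R S S *:%R (vector_field g)
  (vector_field_linear g).

Lemma vector_field_derivation g : derivation (vector_field g : {linear S -> S}).
Proof.
move=> p q; rewrite /= /vector_field mulr_suml mulr_sumr -big_split.
by apply: eq_bigr => i _ /=; rewrite mderivM; ring.
Qed.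

Lemma vector_fieldX g i : vector_field g 'X_i = g 0 i.
Proof.
have U0 : (U_(i) - U_(i) = 0 :> 'X_{1..n})%MM by apply/mnmP => k; rewrite !mnmE subnn.
rewrite /vector_field (bigD1 i) //= mderivX mnm1E eqxx U0 mpolyX0 scale1r mulr1.
rewrite big1 ?addr0 // => j ji; rewrite mderivX mnm1E eq_sym (negPf ji).
by rewrite scale0r mulr0.
Qed.

Lemma derivation_vector_field (eta : {linear S -> S}) : derivation eta ->
  forall p, eta p = vector_field (\row_i eta 'X_i) p.
Proof.
move=> he; set g := \row_i _; have hg := vector_field_derivation g.
have D1 (th : {linear S -> S}) : derivation th -> th 1 = 0.
  move=> ht; have := ht 1 1; rewrite !(mul1r, mulr1) => /eqP.
  by rewrite -[X in X == _]addr0 (inj_eq (addrI _)) eq_sym => /eqP.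
elim/mpoly_closed_ind => [|i|p q hp hq|p q hp hq|c p hp].
- by rewrite D1 // (D1 (vector_field g : {linear S -> S})).
- by rewrite vector_fieldX mxE.
- by rewrite he hp hq [RHS]hg.
- by rewrite !linearD /= hp hq.
- by rewrite !linearZ /= hp.
Qed.

Lemma linear_linform (eta : {linear S -> S}) c :
  eta (linform c) = \sum_i c 0 i *: eta 'X_i.
Proof. by rewrite /linform linear_sum; apply: eq_bigr => i _ /=; rewrite linearZ. Qed.

Lemma free_of_matrix (cs : seq 'rV[R]_n) (A : seq {vspace 'rV[R]_n})
    (r : nat) (hr : r = n) (d : 'I_r -> nat) (g : 'I_r -> 'rV[S]_n) (K : fieldType) (phi : {rmorphism S -> K}) :
  (forall H, H \in A <-> exists2 c, c \in cs & H = hyperplane c) ->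
  uniq cs -> {in cs, forall c, normalized c} ->
  (forall i j, g i 0 j \is (d i).-homog) ->
  (forall i c, c \in cs -> divides (linform c) (\sum_j c 0 j *: g i 0 j)) ->
  (\sum_i d i)%N = size cs ->
  (forall u : 'I_r -> K, (forall j, \sum_i u i * phi (g i 0 j) = 0) -> forall i, u i = 0) ->
  exists theta : 'I_r -> {linear S -> S},
    logder_basis A theta /\ forall i, homog_derivation (d i) (theta i).
Proof.
subst r => hA cs_uniq cs_norm hg hdiv hd hind.
pose M : 'M[S]_n := \matrix_(i, j) g i 0 j.
have Mrow i j : M i j = g i 0 j by rewrite mxE.
have M_homog i j : M i j \is (d i).-homog by rewrite Mrow.
have M_div i c : c \in cs -> divides (linform c) (\sum_j c 0 j *: M i j).
  by move=> cc; under eq_bigr do rewrite Mrow; apply: hdiv.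
have det0 : \det M != 0.
  pose Mr := map_mx phi M.
  suff : \det Mr != 0 by rewrite det_map_mx; apply: contraNneq => ->; rewrite rmorph0.
  apply/det0P => -[v v0 vM]; case/negP: v0; apply/eqP/rowP => i; rewrite mxE.
  apply: (hind (fun i => v 0 i)) => j; have /rowP/(_ j) := vM.
  rewrite [LHS]mxE [RHS]mxE => e; rewrite -[RHS]e; apply: eq_bigr => k _.
  by rewrite !mxE.
exists (fun i => vector_field (g i) : {linear S -> S}); split; last first.
  by move=> i j; rewrite /= vector_fieldX.
have combE (f : 'I_n -> S) p : \sum_(i < n) f i * vector_field (g i) p =
   vector_field ((\row_i f i) *m M) p.
  rewrite /vector_field; under eq_bigr do rewrite mulr_sumr.
  rewrite exchange_big; apply: eq_bigr => j _ /=; rewrite mxE mulr_suml.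
  by apply: eq_bigr => i _; rewrite !mxE mulrA.
split.
  move=> i; split; first exact: vector_field_derivation.
  move=> H /hA[c cc ->] c' /(hyperplane_eq (normalized_neq0 (cs_norm c cc)))[a ->].
  have [q qE] := hdiv i c cc; exists q.
  rewrite linear_linform /=; under eq_bigr do rewrite vector_fieldX mxE -scalerA.
  by rewrite -scaler_sumr qE linformZ scalerAl.
move=> eta [heta hlog].
pose y : 'rV[S]_n := \row_i eta 'X_i.
have [|f fE] := saito_span cs_uniq cs_norm M_homog M_div hd det0 (y := y).
  move=> c cc; have [q qE] := hlog _ ((hA _).2 (ex_intro2 _ _ c cc erefl)) c erefl.
  exists q; rewrite -qE linear_linform; apply: eq_bigr => j _.
  by rewrite mxE.
exists [ffun i => f 0 i]; split.
  move=> p; rewrite (derivation_vector_field heta) -/y fE.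
  rewrite -[f in LHS](_ : \row_i f 0 i = f); last by apply/rowP => i; rewrite mxE.
  by rewrite -combE; apply: eq_bigr => i _; rewrite ffunE.
move=> f' hf'; apply/ffunP => i; rewrite ffunE.
have : f *m M = (\row_i f' i) *m M.
  rewrite -fE; apply/rowP => j; have := hf' 'X_j; rewrite combE vector_fieldX => <-.
  by rewrite mxE.
by move/(saito_free det0) => ->; rewrite mxE.
Qed.

End Derivations.

(** * Homogeneous components *)

Section HomogeneousComponents.
Variables (R : fieldType) (n : nat).
Local Notation S := {mpoly R[n]}.
Local Notation comp d p := (pihomog mdeg d p).

Lemma sum_comp (p : S) : p = \sum_(k < msize p) comp k p.
Proof. exact: pihomog_partitionE. Qed.

Lemma pihomogM_homog (p q : S) e d :
  p \is e.-homog -> comp (e + d) (p * q) = p * comp d q.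
Proof.
move=> hp; rewrite {1}(sum_comp q) mulr_sumr linear_sum /=.
rewrite [in RHS](sum_comp q) [in RHS]linear_sum mulr_sumr.
apply: eq_bigr => k _; have hk := @pihomogP _ _ mdeg k q.
have hpk := dhomogM hp hk.
have [<-|kd] := eqVneq (k : nat) d.
  by rewrite /= (pihomog_dE hpk) (pihomog_dE hk).
rewrite /= (pihomog_ne0 kd hk) mulr0 (pihomog_ne0 _ hpk) ?eqn_add2l //.
Qed.

Lemma homog_cancel (p q : S) e d :
  p != 0 -> p \is e.-homog -> p * q \is (e + d).-homog -> q \is d.-homog.
Proof.
move=> p0 hp hpq; rewrite homog_piE; apply/eqP/(mulfI p0).
by rewrite -(pihomogM_homog _ _ hp) pihomog_dE.
Qed.

Lemma divides_comp (p q : S) d : p \is 1.-homog -> divides p q -> divides p (comp d.+1 q).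
Proof. by move=> hp [r ->]; exists (comp d r); rewrite -add1n pihomogM_homog. Qed.

Lemma dhomog_scale_cancel (c : R) (p : S) d : c != 0 -> c *: p \is d.-homog -> p \is d.-homog.
Proof. by move=> c0 hp; rewrite -[p](scalerK c0); apply: dhomogZ. Qed.

Lemma substvar_homog i (e : S) d p : e \is 1.-homog -> p \is d.-homog -> substvar i e p \is d.-homog.
Proof.
move=> he /dhomogP hp; rewrite [p]mpolyE rmorph_sum big_seq_cond; apply: rpred_sum => m.
rewrite andbT => /hp <-; rewrite substvarZ; apply: dhomogZ.
rewrite mpolyXE_id rmorph_prod /= mdegE; apply: dhomog_bigprod => j.
rewrite rmorphXn substvarX -[X in X.-homog]mul1n; apply: dhomogMn.
by case: eqP => // _; rewrite dhomogX /= mdeg1.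
Qed.

Lemma substvar_comp i (e : S) d p : e \is 1.-homog ->
  substvar i e (comp d p) = comp d (substvar i e p).
Proof.
move=> he; have pE := sum_comp p.
rewrite {1}pE [in RHS]pE linear_sum !rmorph_sum linear_sum /=; apply: eq_bigr => k _.
have hk := @pihomogP _ _ mdeg k p; have hsk := substvar_homog i he hk.
have [<-|kd] := eqVneq (k : nat) d; first by rewrite (pihomog_dE hk) (pihomog_dE hsk).
by rewrite (pihomog_ne0 kd hk) (pihomog_ne0 kd hsk) rmorph0.
Qed.

(* Homogeneity of degree [d] when the polynomial variable also has degree 1. *)
Definition bihomog d (p : {poly S}) :=
  forall r, p`_r \is (d - r).-homog /\ ((d < r)%N -> p`_r = 0).

Lemma bihomog1 : bihomog 0 1.
Proof.
move=> r; rewrite coef1; split; first by case: r => [|r]; rewrite ?dhomog1 ?dhomog0.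
by case: r.
Qed.

Lemma bihomogD d p q : bihomog d p -> bihomog d q -> bihomog d (p + q).
Proof.
move=> hp hq r; have [p1 p2] := hp r; have [q1 q2] := hq r; rewrite coefD.
by split; [apply: dhomogD|move=> dr; rewrite p2 ?q2 ?addr0].
Qed.

Lemma bihomogM d e p q : bihomog d p -> bihomog e q -> bihomog (d + e) (p * q).
Proof.
move=> hp hq r; rewrite coefM.
have term i : (i <= r)%N -> (i <= d)%N /\ (r - i <= e)%N \/ p`_i * q`_(r - i) = 0.
  move=> ir; have [di|di] := ltnP d i; first by right; rewrite (hp i).2 ?mul0r.
  have [ei|ei] := ltnP e (r - i); first by right; rewrite (hq (r - i)%N).2 ?mulr0.
  by left.
split=> [|dr].
  apply: rpred_sum => i _; have ir : (i <= r)%N by rewrite -ltnS.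
  case: (term i ir) => [[id ie]|->]; last exact: dhomog0.
  have := dhomogM (hp i).1 (hq (r - i)%N).1; congr (_ \is _.-homog); lia.
apply: big1 => i _; have ir : (i <= r)%N by rewrite -ltnS.
by case: (term i ir) => [[id ie]|//]; lia.
Qed.

Lemma bihomogX : bihomog 1 'X.
Proof.
move=> r; rewrite coefX; split; last by case: r => [|[|r]].
by case: eqP => [->|_]; rewrite ?dhomog1 ?dhomog0.
Qed.

Lemma bihomogC d (c : S) : c \is d.-homog -> bihomog d c%:P.
Proof. by move=> hc r; rewrite coefC; case: r => [|r]; rewrite ?subn0 ?dhomog0. Qed.

Lemma bihomog_exp d p k : bihomog d p -> bihomog (d * k) (p ^+ k).
Proof.
move=> hp; elim: k => [|k IH]; first by rewrite muln0 expr0; apply: bihomog1.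
by rewrite exprS mulnS; apply: bihomogM.
Qed.

Lemma bihomog_prod (I : Type) (s : seq I) (F : I -> {poly S}) d :
  (forall i, bihomog d (F i)) -> bihomog (d * size s) (\prod_(i <- s) F i).
Proof.
move=> hF; elim: s => [|i s IH]; first by rewrite big_nil muln0; apply: bihomog1.
by rewrite big_cons /= mulnS; apply: bihomogM.
Qed.

Lemma bihomog_horner d p x : bihomog d p -> x \is 1.-homog -> p.[x] \is d.-homog.
Proof.
move=> hp hx; rewrite horner_coef; apply: rpred_sum => r _.
have [dr|rd] := ltnP d r; first by rewrite (hp r).2 // mul0r dhomog0.
have := dhomogM (hp r).1 (dhomogMn r hx); congr (_ \is _.-homog); lia.
Qed.

End HomogeneousComponents.

(** * The derivations of type B *)

Section LeadingForm.
Variables (R : numFieldType) (n : nat).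
Local Notation S := {mpoly R[n]}.

Lemma euler_solution_homog (N P : {poly S}) (f x : S) (C : int) G d :
  x != 0 -> x \is 1.-homog -> f * x ^+ G = N.[x] ->
  (N \Po - 'X) * 'X^G = - N * (- 'X) ^+ G ->
  N^`() * 'X - N *+ G = C%:~R *: P -> bihomog (G + d) P -> f \is d.-homog.
Proof.
move=> x0 hx fN Nodd Node hP.
have NG : N`_G = 0.
  have XG : 'X^G != 0 :> {poly S} by rewrite expf_eq0 polyX_eq0 andbF.
  have e1 : N \Po - 'X = (- (-1) ^+ G)%:P * N.
    apply: (mulIf XG); rewrite Nodd (exprNn 'X) polyCN polyC_exp polyCN; ring.
  have /(congr1 (fun p : {poly S} => p`_G)) := e1.
  rewrite coef_comp_oppX coefCM mulNr => /eqP; rewrite -subr_eq0 opprK -mulr2n -scaler_nat.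
  by rewrite scaler_eq0 pnatr_eq0 /= mulf_eq0 signr_eq0 => /eqP.
have hN : bihomog (G + d) N.
  move=> r; have [->|rG] := eqVneq r G.
    by rewrite NG; split; rewrite ?dhomog0.
  have r0 : (r%:R - G%:R : R) != 0 by rewrite subr_eq0 eqr_nat.
  have Nr : (r%:R - G%:R : R) *: N`_r = (C%:~R : R) *: P`_r.
    have := congr1 (fun p : {poly S} => p`_r) Node.
    rewrite coefB coefMX coefMn coef_deriv coefZ mulrzl => e.
    by rewrite scalerBl !scaler_nat scaler_int -e; case: (r) => [|k]; rewrite ?mulr0n.
  split; last first.
    move=> dr; move/eqP: Nr; rewrite (hP r).2 // scaler0 scaler_eq0 (negPf r0).
    by move/eqP.
  by apply: (dhomog_scale_cancel r0); rewrite Nr; apply/dhomogZ/(hP r).1.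
have := bihomog_horner hN hx; rewrite -fN mulrC.
apply: homog_cancel; first by rewrite expf_neq0.
by rewrite -[X in X.-homog]mul1n; apply: dhomogMn.
Qed.

End LeadingForm.

Section Basis.
Variables (R : realType) (l a : nat).
Hypothesis l_gt0 : (0 < l)%N.
Local Notation S := {mpoly R[l + 1]}.

Definition xvar (i : 'I_l) : S := 'X_(lshift 1 i).
Definition zvar : S := 'X_(rshift l ord0).
Let w : S := (2^-1 : R) *: zvar.
Let eps : {rmorphism S -> S} := substvar (rshift l ord0) 0.

(* Independence at [z = 0] is tested at the point [x = (1, ..., l)]. *)
Definition sample_point (k : 'I_(l + 1)) : R :=
  match split k with inl i => i.+1%:R | inr _ => 0 end.

Let wz : w *+ 2 = zvar.
Proof. by rewrite /w -scaler_nat scalerA divff ?scale1r // pnatr_eq0. Qed.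

Let X_neq0 k : 'X_k != 0 :> S.
Proof.
apply/eqP => /(congr1 (meval (fun=> 1))) /eqP.
by rewrite /= mevalXU meval0 oner_eq0.
Qed.

Let z0 : zvar != 0. Proof. exact: X_neq0. Qed.

Let eps_z : eps zvar = 0. Proof. by rewrite /zvar substvarX eqxx. Qed.

Let eps_w : eps w = 0. Proof. by rewrite substvarZ eps_z scaler0. Qed.

Let eps_ker s : eps s = 0 -> exists t, s = w * t.
Proof.
move/substvar_ker; rewrite subr0 => -[q ->]; exists (2 *: q).
by rewrite /w -scalerAr -scalerAl scalerA divff ?scale1r // pnatr_eq0.
Qed.

Let eps_x i : eps (xvar i) = xvar i.
Proof. by rewrite /xvar substvarX eq_lrshift. Qed.

Let x_homog i : xvar i \is 1.-homog. Proof. by rewrite dhomogX /= mdeg1. Qed.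

Let z_homog : zvar \is 1.-homog. Proof. by rewrite dhomogX /= mdeg1. Qed.

Lemma sample_x i : (xvar i).@[sample_point] = i.+1%:R.
Proof. by rewrite mevalXU /sample_point -[lshift 1 i]/(unsplit (inl i)) unsplitK. Qed.

Let sample_z : zvar.@[sample_point] = 0.
Proof. by rewrite mevalXU /sample_point -[rshift l _]/(unsplit (inr _)) unsplitK. Qed.

Let x_nonint i (c : int) : xvar i != w *~ c.
Proof.
apply/eqP => /(congr1 (meval sample_point)) /eqP; rewrite sample_x rmorphMz /= mevalZ sample_z.
by rewrite mulr0 mul0rz pnatr_eq0.
Qed.

Let natU k : (k.+1%:R : S) \is a GRing.unit.
Proof.
have -> : (k.+1%:R : S) = (k.+1%:R : R)%:MP by rewrite rmorph_nat.
apply/unitrP; exists ((k.+1%:R)^-1 : R)%:MP.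
by rewrite -!mpolyCM mulVf ?mulfV ?pnatr_eq0.
Qed.

Let sample_eps f : (eps f).@[sample_point] = f.@[sample_point].
Proof.
have [q qE] := substvar_congr (rshift l ord0) 0 f.
have /eqP := congr1 (meval sample_point) qE.
by rewrite rmorphB rmorphM subr0 /= sample_z mul0r subr_eq0 => /eqP.
Qed.

Definition wdeg n := (2 * n + 1 + 2 * a * (l - 1))%N.

Lemma lifted_derivation n : exists (F : 'I_l -> S),
  [/\ forall i, F i \is (wdeg n).-homog,
      forall i j (s : int), i != j -> (`|s| <= a)%N ->
        divides (xvar i + xvar j - zvar *~ s) (F i + F j) /\
        divides (xvar i - xvar j - zvar *~ s) (F i - F j),
      forall i (s : int), (`|s| <= n)%N -> divides (xvar i - zvar *~ s) (F i) &
      exists (E : nat) (N : {poly R}) (C : R), [/\ C != 0,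
        forall i, (F i).@[sample_point] * i.+1%:R ^+ (E + 2 * a) = N.[i.+1%:R],
        (N \Po - 'X) * 'X^(E + 2 * a) = - N * (- 'X) ^+ (E + 2 * a) &
        N^`() * 'X - N *+ (E + 2 * a) =
          C *: ('X^(E + 1 + 2 * n) * \prod_(k < l) ('X^2 - (k.+1%:R ^+ 2)%:P) ^+ a)]].
Proof.
have w0 : w != 0 by rewrite scaler_eq0 (negPf z0) orbF invr_eq0 pnatr_eq0.
have [f [f_pair f_zero [E [N [C [C0 fN Nodd Node]]]]]] :=
  antiderivation_exists a n natU w0 eps_w eps_ker eps_x x_nonint.
pose D := wdeg n.
have DE : D = (wdeg n).-1.+1 by rewrite prednK // /wdeg addnAC addn1.
have ef_homog i : eps (f i) \is D.-homog.
  apply: (euler_solution_homog (x := xvar i) _ (x_homog i) (fN i) Nodd Node).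
    exact: X_neq0.
  have -> : (E + 2 * a + D = E + 1 + 2 * n + 2 * a * l)%N.
    rewrite /D /wdeg; case: l l_gt0 => // l' _; rewrite subn1 mulnS; lia.
  have hB : bihomog (2 * a * size (index_enum 'I_l))
      (\prod_(k < l) ('X^2 - (xvar k ^+ 2)%:P) ^+ a).
    apply: bihomog_prod => k; apply: bihomog_exp; apply: bihomogD.
      exact: (bihomog_exp 2 (@bihomogX _ _)).
    by rewrite -polyCN; apply: bihomogC; rewrite rpredN -[2%N]mul1n; apply: dhomogMn.
  have sz : size (index_enum 'I_l) = l.
    by rewrite -[RHS](card_ord l) cardT enumT.
  rewrite sz in hB; apply: bihomogM hB.
  by rewrite -[X in bihomog X]mul1n; apply: bihomog_exp; apply: bihomogX.
have pair_div (b : bool) i j (s : int) : i != j -> (`|s| <= a)%N ->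
    divides (xvar i - ((-1) ^+ b * xvar j + zvar *~ s)) (f i - (-1) ^+ b * f j).
  move=> ij sa; set e := (_ * _ + _); apply: substvar_ker.
  set sg := substvar _ _.
  pose phi : {rmorphism S -> {fraction S}} := @tofrac S \o sg.
  have sgxi : sg (xvar i) = e by rewrite substvarX eqxx.
  have sgxj : sg (xvar j) = xvar j.
    by rewrite substvarX (inj_eq (@lshift_inj _ _)) eq_sym (negPf ij).
  have sgz : sg zvar = zvar by rewrite substvarX eq_rlshift.
  have sgw : sg w = w by rewrite substvarZ sgz.
  have phi_w : phi w != 0 by rewrite /= sgw tofrac_eq0.
  have phi_x (c : int) : phi (xvar j) <> phi w *~ c.
    rewrite -(rmorphMz phi) /= rmorphMz sgw sgxj => /eqP.
    by rewrite tofrac_eq (negPf (x_nonint j c)).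
  suff : phi (f i) = (-1) ^+ b * phi (f j).
    move=> h; apply/eqP; rewrite -tofrac_eq0 -[tofrac _]/(phi _) rmorphB rmorphM h.
    by case: (b); rewrite ?expr1 ?expr0 ?rmorphN1 ?rmorph1 subrr.
  have phixi : phi (xvar i) = (-1) ^+ b * phi (xvar j) + phi zvar *~ s.
    rewrite /= sgxi sgxj sgz /e tofracD raddfMz /=; congr (_ + _).
    by case: (b); rewrite ?expr1 ?expr0 ?mulN1r ?mul1r ?tofracN.
  have [k [sk|sk]] : exists k : nat, s = k%:Z \/ s = - k%:Z.
  - by case: (s) => k; [exists k; left|exists k.+1; right].
  - have ka : (k <= a)%N by move: sa; rewrite sk.
    have := f_pair _ phi i j false b k phi_w phi_x ka.
    by rewrite expr0 !mul1r wz; apply; rewrite phixi sk pmulrn.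
  have ka : (k <= a)%N by move: sa; rewrite sk abszN.
  have := f_pair _ phi i j true (~~ b) k phi_w phi_x ka.
  rewrite wz phixi sk mulrNz expr1 !mulN1r signrN !mulNr opprD opprK pmulrn.
  by move=> /(_ erefl)/oppr_inj.
have homog_lin i (b : bool) j (s : int) :
    xvar i - ((-1) ^+ b * xvar j + zvar *~ s) \is 1.-homog.
  apply: rpredB => //; apply: rpredD.
    by case: b; rewrite ?expr1 ?expr0 ?mulN1r ?mul1r ?rpredN.
  by rewrite -scaler_int; apply: dhomogZ.
exists (fun i => pihomog mdeg D (f i)); split.
- by move=> i; apply: pihomogP.
- move=> i j s ij sa; split.
    have := pair_div true i j s ij sa; have := homog_lin i true j s.
    rewrite expr1 !mulN1r opprK opprD opprK addrA => h1 h2.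
    by rewrite -pihomogD DE; apply: divides_comp.
  have := pair_div false i j s ij sa; have := homog_lin i false j s.
  rewrite expr0 !mul1r opprD addrA => h1 h2.
  by rewrite -pihomogB DE; apply: divides_comp.
- move=> i s sn; rewrite DE; apply: divides_comp.
    by apply: rpredB; [exact: x_homog|rewrite -scaler_int; apply/dhomogZ/z_homog].
  apply: substvar_ker; set sg := substvar _ _.
  pose phi : {rmorphism S -> {fraction S}} := @tofrac S \o sg.
  have sgz : sg zvar = zvar by rewrite substvarX eq_rlshift.
  have phi_w : phi w != 0 by rewrite /= substvarZ sgz tofrac_eq0.
  have phixi : phi (xvar i) = phi zvar *~ s.
    by rewrite /= substvarX eqxx raddfMz /= sgz.
  apply/eqP; rewrite -tofrac_eq0 -[tofrac _]/(phi _); apply/eqP.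
  have [k [sk|sk]] : exists k : nat, s = k%:Z \/ s = - k%:Z.
  - by case: (s) => k; [exists k; left|exists k.+1; right].
  - apply: (f_zero _ phi i false k phi_w); first by move: sn; rewrite sk.
    by rewrite wz phixi sk expr0 mul1r pmulrn.
  apply: (f_zero _ phi i true k phi_w); first by move: sn; rewrite sk abszN.
  by rewrite wz phixi sk expr1 mulN1r mulrNz pmulrn.
pose ev : {rmorphism S -> R} := meval sample_point.
exists E, (map_poly ev N), C%:~R; split.
- by rewrite intr_eq0.
- move=> i; rewrite -sample_x -[(xvar i).@[_]]/(ev _) horner_map -fN rmorphM rmorphXn.
  congr (_ * _); rewrite -sample_eps /eps substvar_comp ?dhomog0 // -/eps.
  by rewrite (pihomog_dE (ef_homog i)).
- have := congr1 (map_poly ev) Nodd; rewrite !rmorphM /= map_comp_poly !rmorphXn !rmorphN /=.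
  by rewrite map_polyX.
have := congr1 (map_poly ev) Node; rewrite rmorphB rmorphM raddfMn /= map_polyX -deriv_map => ->.
rewrite map_polyZ rmorph_int rmorphM /= map_polyXn rmorph_prod; congr (_ *: (_ * _)).
apply: eq_bigr => k _; rewrite rmorphXn rmorphB /= map_polyXn; congr ((_ - _) ^+ _).
have -> : map_poly ev (xvar k ^+ 2)%:P = (ev (xvar k ^+ 2))%:P by apply: map_polyC.
by rewrite rmorphXn /ev /= sample_x.
Qed.

End Basis.

(** * Freeness of the cone *)

Lemma allpairs_uniq_in (S T U : eqType) (f : S -> T -> U) (s : seq S) (t : seq T) :
  uniq s -> uniq t ->
  (forall x y x' y', x \in s -> x' \in s -> f x y = f x' y' -> x = x' /\ y = y') ->
  uniq [seq f x y | x <- s, y <- t].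
Proof.
move=> us ut hf; apply: allpairs_uniq us ut _ => p q.
case/allpairsP => -[x y] [xs _ ->]; case/allpairsP => -[x' y'] [xs' _ ->] e.
by have [-> ->] := hf x y x' y' xs xs' e.
Qed.

Lemma triangular_sum2 l : (2 * \sum_(i < l) i = l * (l - 1))%N.
Proof.
elim: l => [|k IH]; first by rewrite big_ord0.
by rewrite big_ord_recr /= mulnDr IH; case: (k) => //= k'; rewrite !subn1 /=; nia.
Qed.

Section Forms.
Variables (R : realType) (l m a : nat).
Local Notation unitv := (@unitv R l).

Lemma mem_int_range k (s : R) :
  reflect (exists2 t : int, (`|t| <= k)%N & s = t%:~R) (s \in int_range k).
Proof.
apply: (iffP mapP) => [[i]|[t tk ->]].
  by rewrite mem_iota => ik ->; exists (i%:Z - k%:Z) => //; lia.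
exists (absz (t + k%:Z)); first by rewrite mem_iota; lia.
by congr (_%:~R); lia.
Qed.

Lemma int_range_uniq k : uniq (@int_range R k).
Proof.
rewrite map_inj_uniq ?iota_uniq // => i j /intr_inj /addIr.
by case.
Qed.

Lemma mem_index_pairs (p : 'I_l * 'I_l) : (p \in index_pairs l) = (p.1 < p.2)%N.
Proof. by rewrite mem_filter mem_enum andbT. Qed.

Variant B0_spec (p : 'rV[R]_l * R) : Prop :=
| B0_add (i j : 'I_l) (t : int) of (i < j)%N & (`|t| <= a)%N & p = (unitv i + unitv j, t%:~R)
| B0_sub (i j : 'I_l) (t : int) of (i < j)%N & (`|t| <= a)%N & p = (unitv i - unitv j, t%:~R)
| B0_one (i : 'I_l) (t : int) of (`|t| <= m)%N & p = (unitv i, t%:~R).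

Lemma B0P p : reflect (B0_spec p) (p \in B0 R l m a).
Proof.
rewrite !mem_cat; apply: (iffP or3P) => [[]|].
- case/allpairsP => -[[i j] s] /= []; rewrite mem_index_pairs => ij /mem_int_range[t ta ->] ->.
  exact: (B0_add ij ta).
- case/allpairsP => -[[i j] s] /= []; rewrite mem_index_pairs => ij /mem_int_range[t ta ->] ->.
  exact: (B0_sub ij ta).
- by case/allpairsP => -[i s] /= [_ /mem_int_range[t ta ->] ->]; apply: (B0_one ta).
case=> [i j t ij ta ->|i j t ij ta ->|i t tm ->].
- apply: Or31; apply/allpairsP; exists ((i, j), t%:~R); rewrite mem_index_pairs.
  by split=> //; apply/mem_int_range; exists t.
- apply: Or32; apply/allpairsP; exists ((i, j), t%:~R); rewrite mem_index_pairs.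
  by split=> //; apply/mem_int_range; exists t.
apply: Or33; apply/allpairsP; exists (i, t%:~R); rewrite mem_enum.
by split=> //; apply/mem_int_range; exists t.
Qed.

Lemma unitvE i k : unitv i 0 k = (k == i)%:R.
Proof. by rewrite mxE. Qed.

Let coord_sum (u : 'rV[R]_l) := \sum_k u 0 k.

Let coord_sum_unitv i : coord_sum (unitv i) = 1.
Proof.
rewrite /coord_sum (bigD1 i) //= unitvE eqxx big1 ?addr0 // => k /negPf ki.
by rewrite unitvE ki.
Qed.

Let coord_sumD u v : coord_sum (u + v) = coord_sum u + coord_sum v.
Proof. by rewrite /coord_sum -big_split; apply: eq_bigr => k _; rewrite mxE. Qed.

Let coord_sumN u : coord_sum (- u) = - coord_sum u.
Proof. by rewrite /coord_sum -sumrN; apply: eq_bigr => k _; rewrite mxE. Qed.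

Lemma unitv_add_inj (i j i' j' : 'I_l) : (i < j)%N -> (i' < j')%N ->
  unitv i + unitv j = unitv i' + unitv j' -> (i, j) = (i', j').
Proof.
move=> ij ij' e.
have h k : ((k == i) || (k == j)) = ((k == i') || (k == j')).
  have /rowP/(_ k) := e; rewrite !mxE /= -!natrD => /eqP; rewrite eqr_nat.
  by do 4!case: (k == _).
have := h i; have := h j; have := h i'; have := h j'; rewrite !eqxx /= !orbT -!val_eqE /=.
by move=> h1 h2 h3 h4; apply/eqP; rewrite xpair_eqE -!val_eqE /=; lia.
Qed.

Lemma unitv_sub_inj (i j i' j' : 'I_l) : (i < j)%N -> (i' < j')%N ->
  unitv i - unitv j = unitv i' - unitv j' -> (i, j) = (i', j').
Proof.
move=> ij ij' e.
have h k : ((k == i) + (k == j') = (k == i') + (k == j))%N.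
  have /rowP/(_ k) := e; rewrite !mxE /= => /eqP.
  rewrite subr_eq addrAC eq_sym subr_eq -!natrD eqr_nat => /eqP <-.
  by rewrite addnC.
have := h i; have := h j; have := h i'; have := h j'; rewrite !eqxx -!val_eqE /=.
by move=> h1 h2 h3 h4; apply/eqP; rewrite xpair_eqE -!val_eqE /=; lia.
Qed.

Lemma B0_uniq : uniq (B0 R l m a).
Proof.
have pu : uniq (index_pairs l) by rewrite filter_uniq ?enum_uniq.
rewrite !cat_uniq; apply/and3P; split; [| |apply/and3P; split].
- apply: (allpairs_uniq_in pu (int_range_uniq a)) => -[i j] s [i' j'] s'.
  rewrite !mem_index_pairs => h1 h2 [e ->].
  by have [-> ->] := unitv_add_inj h1 h2 e.
- apply/hasPn => p; rewrite mem_cat => hp; apply/negP.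
  case/allpairsP => -[[i j] s] /= [_ _ pE]; move: hp; rewrite pE => /orP[] /allpairsP.
    move=> [[[i' j'] s'] /= [_ _ [/(congr1 coord_sum)]]].
    rewrite !(coord_sumD, coord_sumN, coord_sum_unitv) subrr => /eqP.
    by rewrite -mulr2n pnatr_eq0.
  move=> [[i' s'] /= [_ _ [/(congr1 coord_sum)]]].
  rewrite !(coord_sumD, coord_sumN, coord_sum_unitv) => /eqP.
  by rewrite -subr_eq0 addrK oner_eq0.
- apply: (allpairs_uniq_in pu (int_range_uniq a)) => -[i j] s [i' j'] s'.
  rewrite !mem_index_pairs => h1 h2 [e ->].
  by have [-> ->] := unitv_sub_inj h1 h2 e.
- apply/hasPn => p hp; apply/negP.
  case/allpairsP => -[[i j] s] /= [_ _ pE]; move: hp; rewrite pE => /allpairsP.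
  move=> [[i' s'] /= [_ _ [/(congr1 coord_sum)]]].
  rewrite !(coord_sumD, coord_sumN, coord_sum_unitv) subrr => /eqP.
  by rewrite eq_sym oner_eq0.
apply: (allpairs_uniq_in (enum_uniq _) (int_range_uniq m)) => i s i' s' _ _ [e ->].
have /rowP/(_ i) := e; rewrite !unitvE eqxx.
by case: (i =P i') => [-> //|_ /eqP]; rewrite oner_eq0.
Qed.

Lemma size_index_pairs : (2 * size (index_pairs l) = l * (l - 1))%N.
Proof.
have -> : size (index_pairs l) = (\sum_(j < l) j)%N.
  rewrite size_filter -sum1_count /= big_enum_cond /= big_mkcond /=.
  rewrite (eq_bigr (fun p : 'I_l * 'I_l => (p.1 < p.2)%N : nat)) => [|p _]; last by case: ifP.
  rewrite -(pair_bigA _ (fun i j : 'I_l => (i < j)%N : nat)) exchange_big /=.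
  apply: eq_bigr => j _; rewrite (eq_bigr (fun i : 'I_l => if (i < j)%N then 1%N else 0%N)).
    by rewrite -big_mkcond (big_ord_narrow (ltnW (ltn_ord j))) sum1_card card_ord.
  by move=> i _; case: ifP.
exact: triangular_sum2.
Qed.

End Forms.

Definition bexp (l m a : nat) : seq nat :=
  1%N :: [seq (2 * (m + j) + 1 + 2 * a * (l - 1))%N | j <- iota 0 l].

Section ConeFree.
Variables (R : realType) (l m a : nat).
Local Notation S := {mpoly R[l + 1]}.
Local Notation xvar := (@xvar R l).
Local Notation zvar := (@zvar R l).
Local Notation unitv := (@unitv R l).

Definition coneform (p : 'rV[R]_l * R) : 'rV[R]_(l + 1) := row_mx p.1 (- p.2)%:M.

Definition infinity_form : 'rV[R]_(l + 1) := row_mx 0 1%:M.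

Definition forms : seq 'rV[R]_(l + 1) := infinity_form :: [seq coneform p | p <- B0 R l m a].

Lemma cone_forms : cone (B0 R l m a) = [seq hyperplane c | c <- forms].
Proof. by rewrite /cone /forms /= -map_comp. Qed.

Lemma coneform_inj : injective coneform.
Proof.
move=> [u s] [v t] /eq_row_mx[/= -> /matrixP/(_ 0 0)]; rewrite !mxE !mulr1n => /oppr_inj ->.
by [].
Qed.

Lemma linform_row_mx (u : 'rV[R]_l) (s : R) :
  linform (row_mx u s%:M) = \sum_i u 0 i *: xvar i + s *: zvar.
Proof.
rewrite /linform big_split_ord /= big_ord1; congr (_ + _).
  by apply: eq_bigr => i _; rewrite row_mxEl.
by rewrite row_mxEr mxE eqxx.
Qed.

Let sum_unitv i (x : 'I_l -> S) : \sum_k unitv i 0 k *: x k = x i.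
Proof.
rewrite (bigD1 i) //= unitvE eqxx scale1r big1 ?addr0 // => k /negPf ki.
by rewrite unitvE ki scale0r.
Qed.

Let sum_unitvD i j (x : 'I_l -> S) : \sum_k (unitv i + unitv j) 0 k *: x k = x i + x j.
Proof.
rewrite -(sum_unitv i) -(sum_unitv j) -big_split; apply: eq_bigr => k _.
by rewrite mxE scalerDl.
Qed.

Let sum_unitvB i j (x : 'I_l -> S) : \sum_k (unitv i - unitv j) 0 k *: x k = x i - x j.
Proof.
rewrite -(sum_unitv i) -(sum_unitv j) -sumrB; apply: eq_bigr => k _.
by rewrite !mxE scalerBl.
Qed.

Lemma forms_normalized : {in forms, forall c, normalized c}.
Proof.
have lift_norm (u : 'rV[R]_l) t i : u 0 i = 1 -> (forall k : 'I_l, (k < i)%N -> u 0 k = 0) ->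
    normalized (coneform (u, t)).
  move=> ui hu; exists (lshift 1 i); rewrite row_mxEl; split=> // k.
  by case: (split_ordP k) => k' -> /= ki; rewrite ?row_mxEl ?hu //; have := ltn_ord i; lia.
move=> c; rewrite inE => /orP[/eqP ->|/mapP[p /B0P hp ->]].
  exists (rshift l ord0); rewrite row_mxEr mxE eqxx; split=> // k.
  case: (split_ordP k) => k' -> /=; first by rewrite row_mxEl mxE.
  by rewrite ord1 /= ltnn.
case: hp => [i j t ij _ ->|i j t ij _ ->|i t _ ->]; apply: (@lift_norm _ _ i).
- by rewrite !mxE !eqxx /= -[X in _ + X]/(((i == j)%:R)) -val_eqE ltn_eqF // addr0.
- by move=> k ki; rewrite !mxE /= -!val_eqE !ltn_eqF ?addr0 // (ltn_trans ki ij).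
- by rewrite !mxE !eqxx /= -val_eqE ltn_eqF // subr0.
- by move=> k ki; rewrite !mxE /= -!val_eqE !ltn_eqF ?subr0 // (ltn_trans ki ij).
- by rewrite mxE !eqxx.
by move=> k ki; rewrite mxE /= -val_eqE ltn_eqF.
Qed.

Lemma forms_uniq : uniq forms.
Proof.
rewrite /= (map_inj_uniq coneform_inj) B0_uniq andbT; apply/mapP => -[p pB e].
have /eq_row_mx[p0 _] := e.
have := forms_normalized (mem_behead (s := forms) (map_f coneform pB)).
case/B0P: pB p0 e => [i j t ij _ ->|i j t ij _ ->|i t _ ->] /= /rowP/(_ i) /eqP.
- by rewrite !mxE !eqxx /= -val_eqE ltn_eqF // addr0 eq_sym oner_eq0.
- by rewrite !mxE !eqxx /= -val_eqE ltn_eqF // subr0 eq_sym oner_eq0.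
by rewrite !mxE !eqxx eq_sym oner_eq0.
Qed.

Lemma size_forms : size forms = (\sum_(e <- bexp l m a) e)%N.
Proof.
have sizeI k : size (@int_range R k) = (2 * k + 1)%N.
  by rewrite size_map size_iota -mul2n addn1.
rewrite /= size_map !size_cat !size_allpairs !sizeI size_enum_ord.
rewrite big_cons big_map (_ : iota 0 l = index_iota 0 l); last by rewrite /index_iota subn0.
rewrite big_mkord (eq_bigr (fun i : 'I_l => (2 * m + 1 + 2 * a * (l - 1)) + 2 * i)%N) => [|i _].
  rewrite big_split /= sum_nat_const card_ord -big_distrr /= triangular_sum2.
  have := size_index_pairs l; move: (size _) => X hX.
  transitivity (1 + (l * (2 * m + 1) + 2 * X * (2 * a + 1)))%N; first ring.
  by rewrite hX; ring.
by lia.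
Qed.

Lemma size_bexp : size (bexp l m a) = l.+1.
Proof. by rewrite /= size_map size_iota. Qed.

Lemma nth_bexp j : (j < l)%N -> nth 0%N (bexp l m a) j.+1 = wdeg l a (m + j).
Proof. by move=> jl; rewrite /= (nth_map 0%N) ?size_iota // nth_iota. Qed.

Theorem cone_free : free_with_exponents (cone (B0 R l m a)) (bexp l m a).
Proof.
have /fin_all_exists[F hF] (j : 'I_l) :=
  lifted_derivation R a (leq_ltn_trans (leq0n j) (ltn_ord j)) (m + j).
have F_homog j i : F j i \is (wdeg l a (m + j)).-homog by case: (hF j).
have detF0 : \det (\matrix_(j, i) F j i) != 0.
  have /fin_all_exists[E hE] j : exists E : nat, exists (N : {poly R}) (C : R), [/\ C != 0,
      forall i, (F j i).@[@sample_point R l] * i.+1%:R ^+ (E + 2 * a) = N.[i.+1%:R],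
      (N \Po - 'X) * 'X^(E + 2 * a) = - N * (- 'X) ^+ (E + 2 * a) &
      N^`() * 'X - N *+ (E + 2 * a) =
        C *: ('X^(E + 1 + 2 * (m + j)) * \prod_(k < l) ('X^2 - (k.+1%:R ^+ 2)%:P) ^+ a)].
    by case: (hF j).
  have /fin_all_exists[N hN] := hE; have /fin_all_exists[C hC] := hN.
  suff : \det (map_mx (meval (@sample_point R l)) (\matrix_(j, i) F j i)) != 0.
    by rewrite det_map_mx; apply: contraNneq => ->; rewrite rmorph0.
  apply/det0P => -[v v0 vM]; case/negP: v0; apply/eqP/rowP => j; rewrite mxE.
  apply: (@euler_independence R l a m (fun i : 'I_l => i.+1%:R) _ _ E N C
    (fun j i => (F j i).@[@sample_point R l]) _ _ _ _ (fun j => v 0 j)).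
  - by move=> i; rewrite ltr0n.
  - by move=> i k /eqP; rewrite eqr_nat eqSS => /eqP/val_inj.
  - by move=> k; case: (hC k).
  - by move=> k i; case: (hC k).
  - by move=> k; case: (hC k).
  - by move=> k; case: (hC k).
  move=> i; have /rowP/(_ i) := vM; rewrite [LHS]mxE [RHS]mxE => e; rewrite -[RHS]e.
  by apply: eq_bigr => k _; rewrite !mxE.
pose row_of k : 'rV[S]_(l + 1) :=
  if k is j.+1 then oapp (fun j : 'I_l => row_mx (\row_i F j i) 0) 0 (insub j)
  else \row_i 'X_i.
have row_ofS (j : 'I_l) : row_of j.+1 = row_mx (\row_i F j i) 0 by rewrite /row_of valK.
set e := bexp l m a; have se : size e = l.+1 := size_bexp.
have indexP (i : 'I_(size e)) : i = 0%N :> nat \/ exists j : 'I_l, i = j.+1 :> nat.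
  case: i => [[|j] ji]; [by left|right].
  have jl : (j < l)%N by rewrite -ltnS -se.
  by exists (Ordinal jl).
have sum_row (v : nat -> {fraction S}) k :
    \sum_(i < size e) v i * tofrac (row_of i 0 k) =
    v 0%N * tofrac ('X_k) + \sum_(j < l) v j.+1 * tofrac (row_mx (\row_i F j i) 0 0 k).
  rewrite -(big_mkord xpredT (fun i => v i * tofrac (row_of i 0 k))) se big_mkord big_ord_recl.
  rewrite mxE; congr (_ + _); apply: eq_bigr => j _.
  by rewrite -row_ofS.
apply: (@free_of_matrix R _ forms _ _ _ (fun i => nth 0%N e i) (fun i => row_of i)
   {fraction S} (@tofrac S)).
- by rewrite se addn1.
- move=> H; rewrite cone_forms; split=> [/mapP[c cc ->]|[c cc ->]]; first by exists c.
  exact: map_f.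
- exact: forms_uniq.
- exact: forms_normalized.
- move=> i k; case: (indexP i) => [->|[j ->]]; first by rewrite /= mxE dhomogX /= mdeg1.
  rewrite row_ofS -/(bexp l m a) nth_bexp //; case: (split_ordP k) => k' ->.
    by rewrite row_mxEl mxE.
  by rewrite row_mxEr mxE dhomog0.
- move=> i c cc; case: (indexP i) => [->|[j ->]].
    by exists 1; rewrite mulr1; apply: eq_bigr => k _; rewrite mxE.
  rewrite row_ofS big_split_ord /= [X in _ + X]big1 => [|k _]; last by rewrite row_mxEr mxE scaler0.
  rewrite addr0 (eq_bigr (fun k => c 0 (lshift 1 k) *: F j k)) => [|k _]; last first.
    by rewrite row_mxEl mxE.
  have [_ pairF zeroF _] := hF j.
  move: cc; rewrite inE => /orP[/eqP ->|/mapP[p /B0P hp ->]].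
    by exists 0; rewrite mulr0 big1 // => k _; rewrite row_mxEl mxE scale0r.
  rewrite linform_row_mx (eq_bigr (fun k => p.1 0 k *: F j k)) => [|k _]; last first.
    by rewrite row_mxEl.
  have zE (t : int) : (- t%:~R : R) *: zvar = - (zvar *~ t) by rewrite scaleNr scaler_int.
  case: hp => [i1 i2 t i12 ta ->|i1 i2 t i12 ta ->|i1 t tm ->] /=.
  + rewrite !sum_unitvD zE; have i12' : i1 != i2 by rewrite -val_eqE ltn_eqF.
    exact: (pairF i1 i2 t i12' ta).1.
  + rewrite !sum_unitvB zE; have i12' : i1 != i2 by rewrite -val_eqE ltn_eqF.
    exact: (pairF i1 i2 t i12' ta).2.
  by rewrite !sum_unitv zE; apply: zeroF; apply: leq_trans tm (leq_addr _ _).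
- by rewrite size_forms (big_nth 0%N) big_mkord.
move=> u hu i.
pose v k : {fraction S} := oapp u 0 (insub k).
have uv (k : 'I_(size e)) : u k = v k by rewrite /v valK.
have hv k : v 0%N * tofrac ('X_k) + \sum_(j < l) v j.+1 * tofrac (row_mx (\row_i F j i) 0 0 k) = 0.
  by rewrite -sum_row -[RHS](hu k); apply: eq_bigr => k' _; rewrite uv.
have v0 : v 0%N = 0.
  have := hv (rshift l ord0); rewrite big1 => [|j _]; last first.
    by rewrite row_mxEr mxE tofrac0 mulr0.
  rewrite addr0 => /eqP; rewrite mulf_eq0 tofrac_eq0 => /orP[/eqP //|/eqP X0].
  have := congr1 (meval (fun=> 1)) X0; rewrite /= mevalXU meval0 => /eqP.
  by rewrite oner_eq0.
have vS (j : 'I_l) : v j.+1 = 0.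
  have : \det (map_mx (@tofrac S) (\matrix_(j, i) F j i)) != 0.
    by rewrite det_map_mx tofrac_eq0.
  apply: contraNeq => vj; apply/det0P; exists (\row_j v j.+1).
    by apply/rV0Pn; exists j; rewrite mxE.
  apply/rowP => k; have := hv (lshift 1 k); rewrite v0 mul0r add0r => e1.
  rewrite [LHS]mxE [RHS]mxE -[RHS]e1; apply: eq_bigr => j' _.
  by rewrite row_mxEl !mxE.
by rewrite uv; case: (indexP i) => [->|[j ->]].
Qed.

End ConeFree.

(** * The flag *)

Lemma free_with_exponents_ext (R : realType) (n : nat) (A A' : seq {vspace 'rV[R]_n}) e :
  A =i A' -> free_with_exponents A e -> free_with_exponents A' e.
Proof.
move=> AA' [theta [[th1 th2] th3]]; exists theta; split=> //; split=> [i|eta].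
  by have [d1 d2] := th1 i; split=> // H; rewrite -AA'; apply: d2.
by move=> [d1 d2]; apply: th2; split=> // H; rewrite AA'; apply: d2.
Qed.

Lemma memv_bigcap (K : fieldType) (V : vectType K) (s : seq {vspace V}) v :
  (v \in (\bigcap_(H <- s) H)%VS) = all (fun H : {vspace V} => v \in H) s.
Proof.
elim: s => [|H s IH]; first by rewrite big_nil memvf.
by rewrite big_cons memv_cap IH.
Qed.

Section Parametrization.
Variables (R : realType) (k r m a : nat).
Local Notation l := (k + r)%N.

Definition offset (i : 'I_r) : nat := (m + a * (r - 1 - i))%N.

Definition offsets : 'rV[R]_r := \row_i (offset i)%:R.

Definition param_mx : 'M[R]_(k + 1, l + 1) :=
  block_mx (row_mx 1%:M 0) 0 (row_mx 0 offsets) 1%:M.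

Lemma mul_param_mx (y : 'rV[R]_k) (s : 'M[R]_1) :
  row_mx y s *m param_mx = row_mx (row_mx y (s *m offsets)) s.
Proof.
by rewrite mul_row_block !mul_mx_row !mulmx0 !mulmx1 add0r add_row_mx addr0 add0r.
Qed.

Lemma pull_form (u1 : 'rV[R]_k) (u2 : 'rV[R]_r) (s : 'M[R]_1) :
  row_mx (row_mx u1 u2) s *m param_mx^T =
  row_mx u1 (u2 *m offsets^T + s).
Proof.
rewrite /param_mx tr_block_mx !tr_row_mx !trmx0 !trmx1 mul_row_block.
by rewrite !mul_row_col !mulmx0 !mulmx1 !add0r !addr0.
Qed.

Lemma unitv_lshift (i : 'I_k) : @unitv R _ (lshift r i) = row_mx (@unitv R _ i) 0.
Proof.
apply/rowP => j; rewrite unitvE; case: (split_ordP j) => j' ->.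
  by rewrite row_mxEl unitvE (inj_eq (@lshift_inj _ _)).
by rewrite row_mxEr mxE eq_rlshift.
Qed.

Lemma unitv_rshift (i : 'I_r) : @unitv R _ (rshift k i) = row_mx 0 (@unitv R _ i).
Proof.
apply/rowP => j; rewrite unitvE; case: (split_ordP j) => j' ->.
  by rewrite row_mxEl mxE eq_lrshift.
by rewrite row_mxEr unitvE (inj_eq (@rshift_inj _ _)).
Qed.

Lemma unitv_offsets (i : 'I_r) : @unitv R _ i *m offsets^T = ((offset i)%:R)%:M.
Proof.
apply/matrixP => p q; rewrite !ord1 !mxE (bigD1 i) //= unitvE eqxx mul1r !mxE big1 ?addr0 //.
by move=> j /negPf ji; rewrite unitvE ji mul0r.
Qed.

Lemma offset_le (i : 'I_r) : (offset i + a <= m + a * r)%N.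
Proof.
have ir := ltn_ord i; rewrite /offset -addnA leq_add2l -mulnSr leq_mul2l; apply/orP; right.
by lia.
Qed.

Lemma offset_cover (t : int) : (m < `|t| <= m + a * r)%N ->
  exists i : 'I_r, (`| `|t|%N%:Z - (offset i)%:Z | <= a)%N.
Proof.
case/andP; move: `|t|%N => T mT Ta.
have [a0|a0] := posnP a; first by move: Ta; rewrite a0 mul0n addn0 leqNgt mT.
pose q := ((T - m - 1) %/ a)%N.
have qr : (q < r)%N by rewrite ltn_divLR // [(r * a)%N]mulnC; lia.
have ir : (r - 1 - q < r)%N by lia.
exists (Ordinal ir); rewrite /offset /=.
have -> : (r - 1 - (r - 1 - q) = q)%N by lia.
have := divn_eq (T - m - 1) a; rewrite -/q; have := ltn_pmod (T - m - 1) a0.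
by rewrite [(q * a)%N]mulnC; move: (_ %% a)%N (a * q)%N => p1 p2; lia.
Qed.

(* The restriction of a linear form to the image of [param_mx]. *)
Let pull (c : 'rV[R]_(k + r + 1)) := c *m param_mx^T.

Let pull_coneform u1 u2 s :
  pull (coneform (row_mx u1 u2, s)) = row_mx u1 (u2 *m offsets^T + (- s)%:M).
Proof. exact: pull_form. Qed.

Let pull_infinity : pull (infinity_form R (k + r)) = infinity_form R k.
Proof. by rewrite /pull /infinity_form -[0 : 'rV_(k + r)]row_mx0 pull_form mul0mx add0r. Qed.

Let row_mx_scalar (s : R) : row_mx 0 s%:M = s *: infinity_form R k.
Proof. by rewrite /infinity_form scale_row_mx scaler0 scale_scalar_mx mulr1. Qed.

Local Notation B' := (forms R k (m + a * r) a).

Lemma pulled_in_cone c : c \in forms R (k + r) m a -> pull c != 0 ->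
  hyperplane (pull c) \in [seq hyperplane c | c <- B'].
Proof.
have mem_inf s : s *: infinity_form R k != 0 ->
    hyperplane (s *: infinity_form R k) \in [seq hyperplane c | c <- B'].
  move=> s0; apply/mapP; exists (infinity_form R k); first by rewrite mem_head.
  by apply: hyperplaneZ; apply: contraNneq s0 => ->; rewrite scale0r.
have mem_B p : B0_spec (m + a * r) a p ->
    hyperplane (coneform p) \in [seq hyperplane c | c <- B'].
  by move=> /B0P hp; apply: map_f; rewrite inE map_f ?orbT.
rewrite inE => /orP[/eqP ->|/mapP[p /B0P hp ->]].
  by rewrite pull_infinity => _; apply: map_f; rewrite mem_head.
have intN (u : 'rV[R]_k) (t : int) x : x = (- t%:~R)%:M -> row_mx u x = coneform (u, t%:~R).
  by move=> ->.
case: hp => [i j t|i j t|i t].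
- case: (split_ordP i) => i' ->; case: (split_ordP j) => j' -> /= ij ta ->.
  + rewrite !unitv_lshift add_row_mx addr0 pull_coneform mul0mx add0r => _.
    by rewrite (intN _ t) //; apply: mem_B; exact: (B0_add (i := i') (j := j') _ ij ta (erefl _)).
  + rewrite unitv_lshift unitv_rshift add_row_mx addr0 add0r pull_coneform unitv_offsets.
    rewrite (intN _ (t - (offset j')%:Z)) => [_|].
      apply: mem_B; apply: (B0_one (i := i') _ _ (erefl _)).
      by have := offset_le j'; lia.
    by rewrite -raddfD /= mulrzBr opprB pmulrn.
  + by have := ltn_ord j'; lia.
  rewrite !unitv_rshift add_row_mx addr0 pull_coneform mulmxDl !unitv_offsets -!raddfD /=.
  by rewrite row_mx_scalar; apply: mem_inf.
- case: (split_ordP i) => i' ->; case: (split_ordP j) => j' -> /= ij ta ->.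
  + rewrite !unitv_lshift opp_row_mx add_row_mx subr0 pull_coneform mul0mx add0r => _.
    by rewrite (intN _ t) //; apply: mem_B; exact: (B0_sub (i := i') (j := j') _ ij ta (erefl _)).
  + rewrite unitv_lshift unitv_rshift opp_row_mx add_row_mx oppr0 addr0 add0r.
    rewrite pull_coneform mulNmx unitv_offsets.
    rewrite (intN _ (t + (offset j')%:Z)) => [_|].
      apply: mem_B; apply: (B0_one (i := i') _ _ (erefl _)).
      by have := offset_le j'; lia.
    by rewrite -raddfN -raddfD /= mulrzDr opprD addrC pmulrn.
  + by have := ltn_ord j'; lia.
  rewrite !unitv_rshift opp_row_mx add_row_mx subr0 pull_coneform mulmxBl !unitv_offsets.
  by rewrite -raddfB -raddfD /= row_mx_scalar; apply: mem_inf.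
case: (split_ordP i) => i' -> tm ->.
  rewrite unitv_lshift pull_coneform mul0mx add0r (intN _ t) // => _.
  by apply: mem_B; apply: (B0_one _ _ (erefl _)); lia.
rewrite unitv_rshift pull_coneform unitv_offsets -raddfD /= row_mx_scalar.
exact: mem_inf.
Qed.

Lemma cone_in_pulled c : c \in B' ->
  exists2 d, d \in forms R (k + r) m a & pull d = c.
Proof.
have mem_B p : B0_spec m a p -> coneform p \in forms R (k + r) m a.
  by move=> /B0P hp; rewrite inE map_f ?orbT.
rewrite inE => /orP[/eqP ->|/mapP[p /B0P hp ->]].
  by exists (infinity_form R (k + r)); rewrite ?mem_head ?pull_infinity.
case: hp => [i j t ij ta ->|i j t ij ta ->|i t tm ->].
- exists (coneform (@unitv R _ (lshift r i) + @unitv R _ (lshift r j), t%:~R)).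
    by apply: mem_B; exact: (B0_add (i := lshift r i) (j := lshift r j) _ ij ta (erefl _)).
  by rewrite !unitv_lshift add_row_mx addr0 pull_coneform mul0mx add0r.
- exists (coneform (@unitv R _ (lshift r i) - @unitv R _ (lshift r j), t%:~R)).
    by apply: mem_B; exact: (B0_sub (i := lshift r i) (j := lshift r j) _ ij ta (erefl _)).
  by rewrite !unitv_lshift opp_row_mx add_row_mx subr0 pull_coneform mul0mx add0r.
have [tm'|mt] := leqP `|t| m.
  exists (coneform (@unitv R _ (lshift r i), t%:~R)).
    by apply: mem_B; apply: (B0_one _ _ (erefl _)).
  by rewrite unitv_lshift pull_coneform mul0mx add0r.
have /offset_cover[j hj] : (m < `|t| <= m + a * r)%N by rewrite mt tm.
have ij : (lshift r i < rshift k j)%N by rewrite /= ltn_addr.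
have [t0|t0] := leP 0 t.
  exists (coneform (@unitv R _ (lshift r i) - @unitv R _ (rshift k j), (t - (offset j)%:Z)%:~R)).
    by apply: mem_B; apply: (B0_sub _ ij _ (erefl _)); lia.
  rewrite unitv_lshift unitv_rshift opp_row_mx add_row_mx oppr0 addr0 add0r pull_coneform.
  rewrite mulNmx unitv_offsets -raddfN -raddfD /= mulrzBr /coneform /=.
  by congr (row_mx _ _%:M); rewrite pmulrn; ring.
exists (coneform (@unitv R _ (lshift r i) + @unitv R _ (rshift k j), (t + (offset j)%:Z)%:~R)).
  by apply: mem_B; apply: (B0_add _ ij _ (erefl _)); lia.
rewrite unitv_lshift unitv_rshift add_row_mx addr0 add0r pull_coneform.
rewrite unitv_offsets -raddfD /= mulrzDr /coneform /=.
by congr (row_mx _ _%:M); rewrite pmulrn; ring.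
Qed.

End Parametrization.

Lemma bexp_sorted l m a : sorted leq (bexp l m a).
Proof.
apply/(sortedP 0%N) => i; rewrite size_bexp ltnS => il.
rewrite nth_bexp // /wdeg; case: i il => [|i] il; first by rewrite addnAC addn1.
by rewrite nth_bexp ?(ltnW il) // /wdeg; lia.
Qed.

Lemma take_bexp k r m a : take (k + 1) (bexp (k + r) m a) = bexp k (m + a * r) a.
Proof.
rewrite addn1 /= -map_take take_iota (minn_idPl (leq_addr _ _)); congr (_ :: _).
apply/eq_in_map => j; rewrite mem_iota /= => jk.
have -> : (k + r - 1 = k - 1 + r)%N by lia.
by rewrite mulnDr; nia.
Qed.

Section Flag.
Variables (R : realType) (l m a : nat).
Local Notation V := 'rV[R]_(l + 1).

Definition flag_offset (i : nat) : R := (m + a * (l - 1 - i))%:R.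

(* The equations are not in the arrangement, but the differences [x_i - x_(i+1) = a z] are. *)
Definition flag_space (d : nat) : {vspace V} :=
  (\bigcap_(H <- [seq hyperplane (coneform (@unitv R _ i, flag_offset i))
     | i : 'I_l <- enum 'I_l & (d <= i.+1)%N]) H)%VS.

Lemma mem_coneform (u : 'rV[R]_l) s (v : V) :
  (v \in hyperplane (coneform (u, s))) =
  (\sum_i v 0 (lshift 1 i) * u 0 i == s * v 0 (rshift l ord0)).
Proof.
rewrite mem_hyperplane -[RHS]subr_eq0.
have -> : v *m (coneform (u, s))^T =
    (\sum_i v 0 (lshift 1 i) * u 0 i - s * v 0 (rshift l ord0))%:M.
  apply/matrixP => p q; rewrite !ord1 [LHS]mxE [RHS]mxE eqxx big_split_ord /= big_ord1 mulr1n.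
  rewrite [_^T (rshift _ _) _]mxE row_mxEr [X in _ * X]mxE eqxx mulr1n mulrN [_ * s]mulrC.
  congr (_ - _).
  by apply: eq_bigr => i _; rewrite mxE row_mxEl.
apply/eqP/eqP => [/matrixP/(_ 0 0)|->]; first by rewrite !mxE mulr1n.
by apply/matrixP => p q; rewrite !mxE mul0rn.
Qed.

Lemma sum_unitv_coord i (v : 'I_l -> R) : \sum_j v j * @unitv R l i 0 j = v i.
Proof.
rewrite (bigD1 i) //= unitvE eqxx mulr1 big1 ?addr0 // => j /negPf ji.
by rewrite unitvE ji mulr0.
Qed.

Lemma mem_flag_space d (v : V) :
  reflect (forall i : 'I_l, (d <= i.+1)%N ->
             v 0 (lshift 1 i) = flag_offset i * v 0 (rshift l ord0))
          (v \in flag_space d).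
Proof.
rewrite memv_bigcap; apply: (iffP allP) => [h i di|h H /mapP[i]].
  have /h : hyperplane (coneform (@unitv R _ i, flag_offset i)) \in
      [seq hyperplane (coneform (@unitv R _ i, flag_offset i)) | i : 'I_l <- enum 'I_l & (d <= i.+1)%N].
    by apply: map_f; rewrite mem_filter di mem_enum.
  by rewrite mem_coneform sum_unitv_coord => /eqP.
by rewrite mem_filter => /andP[di _] ->; rewrite mem_coneform sum_unitv_coord h.
Qed.

Lemma flag_space_mono d : (flag_space d <= flag_space d.+1)%VS.
Proof.
apply/subvP => v /mem_flag_space h; apply/mem_flag_space => i di.
exact: h (ltnW di).
Qed.

Lemma flag_space_full : flag_space (l + 1) = fullv.
Proof.
apply/vspaceP => v; rewrite memvf; apply/mem_flag_space => i h.
by exfalso; have := ltn_ord i; lia.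
Qed.

Lemma flag_space_lattice d : in_lattice (cone (B0 R l m a)) (flag_space d).
Proof.
exists [seq H <- cone (B0 R l m a) | (flag_space d <= H)%VS].
  by move=> H; rewrite mem_filter => /andP[].
apply/eqP; rewrite eqEsubv; apply/andP; split.
  apply/subvP => v vX; rewrite memv_bigcap; apply/allP => H.
  by rewrite mem_filter => /andP[/subvP/(_ v vX)].
apply/subvP => v; rewrite memv_bigcap => /allP hv.
have mem_cone p : B0_spec m a p -> (flag_space d <= hyperplane (coneform p))%VS ->
    v \in hyperplane (coneform p).
  move=> /B0P hp sp; apply: hv; rewrite mem_filter sp cone_forms map_f //.
  by rewrite inE map_f ?orbT.
apply/mem_flag_space => i.
have [j] := ubnP (l - i); elim: j i => // j IH i ij di.
have [il|il] := eqVneq i.+1 l.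
  have c0 : flag_offset i = m%:R by rewrite /flag_offset (_ : l - 1 - i = 0)%N ?muln0 ?addn0 //; lia.
  have : v \in hyperplane (coneform (@unitv R l i, (m%:Z)%:~R)).
    apply: mem_cone; first exact: (B0_one _ _ (erefl _)).
    apply/subvP => v' /mem_flag_space/(_ i di) e; rewrite mem_coneform sum_unitv_coord e c0.
    by rewrite pmulrn.
  by rewrite mem_coneform sum_unitv_coord -pmulrn c0 => /eqP.
have i1l : (i.+1 < l)%N by have := ltn_ord i; lia.
pose i1 := Ordinal i1l.
have ii1 : (i < i1)%N by [].
have off : flag_offset i = flag_offset i1 + a%:R.
  by rewrite /flag_offset -natrD -addnA -mulnSr; congr ((_ + a * _)%:R); rewrite /=; lia.
have e1 : v 0 (lshift 1 i1) = flag_offset i1 * v 0 (rshift l ord0).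
  by apply: IH; [move: ij ii1; rewrite /=; lia|apply: leq_trans di _].
have diffE (u : V) : \sum_j u 0 (lshift 1 j) * (@unitv R l i - @unitv R l i1) 0 j =
    u 0 (lshift 1 i) - u 0 (lshift 1 i1).
  rewrite -(sum_unitv_coord i (fun j => u 0 (lshift 1 j))).
  rewrite -(sum_unitv_coord i1 (fun j => u 0 (lshift 1 j))) -sumrB.
  by apply: eq_bigr => k _; rewrite mxE [X in _ * (_ + X)]mxE mulrBr.
have : v \in hyperplane (coneform (@unitv R l i - @unitv R l i1, (a%:Z)%:~R)).
  apply: mem_cone; first exact: (B0_sub _ ii1 _ (erefl _)).
  apply/subvP => v' /mem_flag_space hv'; rewrite mem_coneform diffE.
  rewrite hv' // [X in _ - X]hv'; last exact: leq_trans di _.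
  by rewrite off -mulrBl addrAC subrr add0r pmulrn.
rewrite mem_coneform diffE subr_eq e1 -pmulrn => /eqP ->.
by rewrite off mulrDl addrC.
Qed.

End Flag.

Section FlagMember.
Variables (R : realType) (k r m a : nat).
Local Notation P := (param_mx R k r m a).
Local Notation X := (flag_space R (k + r) m a (k + 1)).

Let P_inv : 'M[R]_(k + r + 1, k + 1) := block_mx (col_mx 1%:M 0) 0 0 1%:M.

Let P_invK : P *m P_inv = 1%:M.
Proof.
rewrite mulmx_block !mulmx0 !mul0mx !addr0 !add0r !mulmx1 mul_row_col !mulmx0 addr0 mulmx1.
by rewrite mul_row_col mulmx0 mulmx1 addr0 -scalar_mx_block.
Qed.

Definition param : 'Hom('rV[R]_(k + 1), 'rV[R]_(k + r + 1)) :=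
  linfun (mulmxr P : 'rV[R]_(k + 1) -> 'rV[R]_(k + r + 1)).

Lemma paramE y : param y = y *m P. Proof. by rewrite lfunE. Qed.

Lemma mem_flag_param v : (v \in X) = (v *m P_inv *m P == v).
Proof.
rewrite -[v]hsubmxK -[lsubmx v]hsubmxK.
set v1 := lsubmx _; set v2 := rsubmx _; set v3 := rsubmx _.
have -> : row_mx (row_mx v1 v2) v3 *m P_inv = row_mx v1 v3.
  by rewrite mul_row_block !mulmx0 addr0 add0r mulmx1 mul_row_col mulmx1 mulmx0 addr0.
rewrite mul_param_mx.
have offE i j : (v3 *m offsets R r m a) i j = (offset m a j)%:R * v3 0 0.
  by rewrite mxE big_ord1 !ord1 [X in _ * X]mxE mulrC.
have foE (i : 'I_r) : flag_offset R (k + r) m a (rshift k i) = (offset m a i)%:R.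
  by rewrite /flag_offset /offset; congr ((_ + _ * _)%:R); rewrite /=; have := ltn_ord i; lia.
apply/mem_flag_space/eqP => [h|/eq_row_mx[/eq_row_mx[_ e] _] i].
  congr (row_mx (row_mx _ _) _); apply/rowP => i; rewrite offE.
  have := h (rshift k i); rewrite !(row_mxEl, row_mxEr) foE => -> //.
  by rewrite /= addn1 ltnS leq_addr.
case: (split_ordP i) => i' -> /= hi; first by exfalso; have := ltn_ord i'; lia.
by rewrite !(row_mxEl, row_mxEr) foE -e offE.
Qed.

Lemma param_mem y : param y \in X.
Proof. by rewrite mem_flag_param paramE -(mulmxA _ P) P_invK mulmx1. Qed.

Lemma param_inj : injective param.
Proof.
move=> y y'; rewrite !paramE => /(congr1 (mulmx^~ P_inv)).
by rewrite /= -!mulmxA P_invK !mulmx1.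
Qed.

Lemma limg_param : limg param = X.
Proof.
apply/vspaceP => v; apply/memv_imgP/idP => [[y _ ->]|]; first exact: param_mem.
rewrite mem_flag_param => /eqP vE; exists (v *m P_inv); rewrite ?memvf //.
by rewrite paramE vE.
Qed.

Lemma flag_space_dim : \dim X = (k + 1)%N.
Proof.
rewrite -limg_param limg_dim_eq ?dimvf; first by rewrite /dim /= mul1n.
by apply/eqP; rewrite capfv; apply/lker0P/param_inj.
Qed.

Definition chart : 'Hom('rV[R]_(k + 1), subvs_of X) := linfun (vsproj X \o param).

Lemma vsval_chart y : vsval (chart y) = param y.
Proof. by rewrite lfunE /= vsprojK // param_mem. Qed.

Lemma chart_bij : bijective chart.
Proof.
exists (fun u => vsval u *m P_inv) => [y|u].
  by rewrite vsval_chart paramE -mulmxA P_invK mulmx1.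
apply: val_inj; rewrite [LHS]vsval_chart paramE.
by apply/eqP; rewrite -mem_flag_param subvsP.
Qed.

Lemma chart_preim (c : 'rV[R]_(k + r + 1)) :
  (chart @^-1: (linfun (vsval : subvs_of X -> _) @^-1: (hyperplane c :&: X)))%VS =
  hyperplane (c *m P^T).
Proof.
apply/vspaceP => y; rewrite -memv_preim -memv_preim lfunE /= memv_cap vsval_chart param_mem.
by rewrite andbT !mem_hyperplane paramE trmx_mul trmxK mulmxA.
Qed.

Lemma flag_space_sub_hyperplane (c : 'rV[R]_(k + r + 1)) :
  (X <= hyperplane c)%VS = (c *m P^T == 0).
Proof.
apply/subvP/eqP => [h|h v].
  apply/eqP; rewrite -trmx_eq0 trmx_mul trmxK; apply/eqP/row_matrixP => i.
  have := h _ (param_mem (delta_mx 0 i)); rewrite mem_hyperplane paramE -mulmxA => /eqP.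
  by rewrite -rowE row0.
rewrite -limg_param => /memv_imgP[y _ ->]; rewrite mem_hyperplane paramE -mulmxA.
by rewrite -[P *m _]trmxK trmx_mul trmxK h trmx0 mulmx0.
Qed.

Lemma flag_restriction_free :
  free_in (k + 1) (restriction (cone (B0 R (k + r) m a)) X) (bexp k (m + a * r) a).
Proof.
exists chart; split; first exact: chart_bij.
apply: free_with_exponents_ext (cone_free R k (m + a * r) a) => H.
rewrite /restriction -map_comp !cone_forms; apply/mapP/mapP.
  move=> [c cB ->]; have [d dF dE] := cone_in_pulled cB.
  exists (hyperplane d); last by rewrite /= chart_preim dE.
  rewrite mem_filter map_f // andbT flag_space_sub_hyperplane dE.
  exact: normalized_neq0 (forms_normalized cB).
move=> [H']; rewrite mem_filter => /andP[d0 /mapP[d dF dE]] ->; rewrite dE in d0 *.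
rewrite flag_space_sub_hyperplane in d0; have /mapP[c cF cE] := pulled_in_cone dF d0.
by exists c => //; rewrite /= chart_preim cE.
Qed.

End FlagMember.

Lemma B_flag_accurate (R : realType) (l m a : nat) :
  flag_accurate_with (cone (B0 R l m a)) (bexp l m a).
Proof.
split; [by rewrite size_bexp addn1|exact: bexp_sorted|exact: cone_free|].
exists (flag_space R l m a); split; first exact: flag_space_full.
  by move=> d _; apply: flag_space_mono.
move=> d /andP[d1 dl]; split; first exact: flag_space_lattice.
  have [[k r] [dE lE]] : exists p : nat * nat, d = (p.1 + 1)%N /\ l = (p.1 + p.2)%N.
    by exists (d.-1, (l - d.-1)%N) => /=; lia.
  by rewrite dE lE; apply: flag_space_dim.
have [[k r] [dE lE]] : exists p : nat * nat, d = (p.1 + 1)%N /\ l = (p.1 + p.2)%N.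
  by exists (d.-1, (l - d.-1)%N) => /=; lia.
by rewrite dE lE take_bexp; apply: flag_restriction_free.
Qed.

Unset Implicit Arguments.

Theorem theorem5p12 (R : realType) (l m a : nat) (hl : (1 <= l)%N) :
  flag_accurate (cone (B0 R l m a)) /\
  flag_accurate_with (cone (CatB R l m))
    (1%N :: [seq (2 * m * l + 2 * i - 1)%N | i <- iota 1 l]).
Proof.
split; first by exists (bexp l m a); apply: B_flag_accurate.
have <- : bexp l m m = 1%N :: [seq (2 * m * l + 2 * i - 1)%N | i <- iota 1 l].
  have -> : iota 1 l = [seq (1 + j)%N | j <- iota 0 l] by rewrite -iotaDl.
  rewrite /bexp -map_comp; congr (_ :: _).
  apply/eq_in_map => j _ /=; have -> : l = (l - 1).+1 by rewrite subn1 prednK.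
  by rewrite subn1 /= mulnS; lia.
exact: B_flag_accurate.
Qed.
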